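(* Fix $\alpha>1$. For all sufficiently large integers $m$ there exists an integer $n=n(\alpha,m)\ge 5$ such that, for an $\alpha$-Pólya urn on $n+1$ colours $0,1,\dots,n$ with initial state $(m,1,1,\dots,1)$, the following two properties hold simultaneously with probability greater than $\frac45$: (a) only colour $0$ is selected more than $2m-1$ times (over the whole infinite run of the urn); and (b) there are at least $5$ colours that are selected exactly $m-1$ times (over the whole infinite run of the urn).
   Context: The $\alpha$-Pólya urn on $n+1$ colours $0,1,\dots,n$ with initial state $(m_0,m_1,\dots,m_n)$ (with $m_i$ the initial number of balls of colour $i$) is the discrete-time process of tallies $(N_j(0),\dots,N_j(n))_{j\ge 0}$ with $N_0(i)=m_i$, defined as follows. Let $(U_j)_{j\ge1}$ be i.i.d. uniform random variables on $[0,1]$. At step $j\ge 1$ the colour $i$ is selected if $$\frac{\sum_{i'<i}N_{j-1}(i')^\alpha}{\sum_{i'=0}^{n}N_{j-1}(i')^\alpha}<U_j\le\frac{\sum_{i'\le i}N_{j-1}(i')^\alpha}{\sum_{i'=0}^{n}N_{j-1}(i')^\alpha}$$ (empty sums are $0$); then $N_j(i)=N_{j-1}(i)+1$ and the other tallies are unchanged. Thus, given the past, colour $i$ is selected with probability proportional to $N_{j-1}(i)^\alpha$. The number of times a colour is selected does not count the balls initially present. *)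

(* Defs.v *)
From mathcomp Require Import all_boot all_order all_algebra finmap.
From mathcomp Require Import all_classical all_reals all_analysis.

Set Implicit Arguments.
Unset Strict Implicit.
Unset Printing Implicit Defensive.

Import Order.TTheory GRing.Theory Num.Theory.

Local Open Scope classical_set_scope.
Local Open Scope ring_scope.
Local Open Scope ereal_scope.
Local Open Scope card_scope.

Definition mutually_independent (R : realType) d (T : measurableType d)
    (P : probability T R) (U : nat -> {RV P >-> R}) : Prop :=
  forall (J : {fset nat}) (B : nat -> set R),
    (forall j, j \in J -> measurable (B j)) ->
    P (\bigcap_(j in [set` J]) (U j @^-1` B j)) =
    \prod_(j <- J) P (U j @^-1` B j).

Definition uniform01 (R : realType) d (T : measurableType d)
    (P : probability T R) (X : {RV P >-> R}) : Prop :=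
  forall B : set R, measurable B ->
    distribution P X B = uniform_prob (@ltr01 R) B.

Definition urn_weight (R : realType) (alpha : R) n (N : 'I_n.+1 -> nat)
    (i : 'I_n.+1) : R := ((N i)%:R `^ alpha)%R.

Definition urn_selects (R : realType) (alpha : R) n (N : 'I_n.+1 -> nat)
    (u : R) (i : 'I_n.+1) : bool :=
  let w := urn_weight alpha N in
  ((\sum_(k < n.+1 | (k < i)%N) w k) / (\sum_(k < n.+1) w k) < u
     <= (\sum_(k < n.+1 | (k <= i)%N) w k) / (\sum_(k < n.+1) w k))%R.

(* [u j] drives the transition from time [j] to time [j.+1]: a sequence indexed
   from 1 in the usual presentation is shifted to start at 0. If [u j <= 0] or
   [1 < u j], which has probability 0, no colour is selected. *)
Fixpoint urn_tally (R : realType) (alpha : R) n (N0 : 'I_n.+1 -> nat)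
    (u : nat -> R) (j : nat) : 'I_n.+1 -> nat :=
  if j is j'.+1 then
    let N := urn_tally alpha N0 u j' in
    fun i => (N i + urn_selects alpha N (u j') i)%N
  else N0.

(* The steps at which colour [i] is selected; its cardinality, possibly
   infinite, is the number of times [i] is selected over the whole run. *)
Definition selection_steps (R : realType) (alpha : R) n (N0 : 'I_n.+1 -> nat)
    (u : nat -> R) (i : 'I_n.+1) : set nat :=
  [set j | urn_selects alpha (urn_tally alpha N0 u j) (u j) i].

Definition initial_state (m n : nat) (i : 'I_n.+1) : nat :=
  if i == ord0 then m else 1%N.

Definition selected_exactly (R : realType) (alpha : R) n (N0 : 'I_n.+1 -> nat)
    (u : nat -> R) (k : nat) (i : 'I_n.+1) : Prop :=
  selection_steps alpha N0 u i #= `I_k.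

Definition selected_more_than (R : realType) (alpha : R) n
    (N0 : 'I_n.+1 -> nat) (u : nat -> R) (k : nat) (i : 'I_n.+1) : Prop :=
  `I_k.+1 #<= selection_steps alpha N0 u i.

Definition only_0_selected_often (R : realType) (alpha : R) (m n : nat)
    (u : nat -> R) : Prop :=
  forall i : 'I_n.+1,
    selected_more_than alpha (@initial_state m n) u (2 * m - 1) i <-> i = ord0.

Definition five_selected_exactly (R : realType) (alpha : R) (m n : nat)
    (u : nat -> R) : Prop :=
  `I_5 #<= [set i | selected_exactly alpha (@initial_state m n) u (m - 1) i].

(* Main.v *)
Require Import Defs.
From mathcomp Require Import all_boot all_order all_algebra finmap.
From mathcomp Require Import all_classical all_reals all_analysis.
From mathcomp Require Import ring lra zify.

(* The urn is embedded in continuous time: independent pure birth processes, one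
   per colour, with rate [k ^ alpha] at [k].  Colour 0 explodes at a time [T]
   which is concentrated at the scale [m ^ (1 - alpha)], and at time [T] the other
   [n] tallies are independent copies of a birth process started at 1.  Their
   probability of having passed [2 * m] is smaller, by a factor exponential in
   [m], than their probability of being equal to [m], and it varies by a smaller
   factor over the range of [T]; so [n] can be chosen to make the first event
   rare for all colours together while the second one occurs many times.

   No continuous time process is constructed.  Transition probabilities are
   exponential sums given by the Kolmogorov equations, expectation over [T] is the
   positive functional replacing [exp (- mu * t)] by the Laplace transform of [T],
   and the resulting function of the tallies is harmonic for the urn chain.  *)

Import Order.TTheory GRing.Theory Num.Theory.
Import numFieldNormedType.Exports.

Local Open Scope classical_set_scope.
Local Open Scope ring_scope.

Set Implicit Arguments.
Unset Strict Implicit.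

(** Two obstacles shape the proof. Harmonic functions are available as products over the colours,
    and having at least five tallies equal to [m] is not of this form; hence a lower bound by a
    difference of two products, one of which charges a factor 1/2 to each tally equal to [m]. This
    difference is at most 1 and, up to a null set, can exceed a positive level infinitely often only
    on the wanted event, so its initial value bounds the probability from below.

    The exponential gap arises because, within a time of order [m ^ (1 - alpha)], already reaching
    [x * m] from 1 is so unlikely that the logarithmic derivative in time of its probability is of
    order [m ^ alpha]. This is the order of the rates between [m] and [2 * m], so each further level
    costs a fixed factor. A relative error [delta] in [T] also changes the probability of passing
    [2 * m] by a factor exponential in [m]; so [delta] is fixed from the gap before [m] grows, and a
    relative variance of order [1 / m] makes Chebyshev's inequality sufficient. *)

(** * Scalar linear differential inequalities *)

Section Comparison.
Variable R : realType.
Implicit Types f df : R -> R.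

Lemma is_derive_mulr f g (u v t : R) :
  is_derive t 1 f u -> is_derive t 1 g v ->
  is_derive t 1 (fun x => f x * g x) (u * g t + f t * v).
Proof.
move=> hf hg.
have := is_deriveM hf hg; rewrite addrC; congr is_derive.
by rewrite [_ *: _]mulrC.
Qed.

Lemma is_derive_expM (c t : R) :
  is_derive t 1 (fun x => expR (c * x)) (c * expR (c * t)).
Proof.
have h : is_derive t 1 (fun x : R => c * x) c.
  have := is_derive_mulr (is_derive_cst c t 1) (is_derive_id t 1).
  by congr is_derive; rewrite mul0r add0r mulr1.
have := @is_derive1_comp _ expR (fun x => c * x) t _ _ (is_derive_expR _) h.
by congr is_derive; rewrite mulrC.
Qed.

Lemma ge0_is_derive_le f df (s t : R) :
  (forall x : R, is_derive x 1 f (df x)) -> s <= t ->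
  (forall x : R, s < x < t -> 0 <= df x) -> f s <= f t.
Proof.
move=> fdf; rewrite le_eqVlt => /predU1P[->//|st] df0.
have cf : {within `[s, t], continuous f}.
  apply: continuous_subspaceT => x.
  by apply: differentiable_continuous; apply/derivable1_diffP; have [] := fdf x.
have [c cst fE] := MVT st (fun x _ => fdf x) cf.
by rewrite -subr_ge0 fE mulr_ge0 ?subr_ge0 ?(ltW st)// df0.
Qed.

Lemma gt0_is_derive_lt f df (s t : R) :
  (forall x : R, is_derive x 1 f (df x)) -> s < t ->
  (forall x : R, s < x < t -> 0 < df x) -> f s < f t.
Proof.
move=> fdf st df0.
have cf : {within `[s, t], continuous f}.
  apply: continuous_subspaceT => x.
  by apply: differentiable_continuous; apply/derivable1_diffP; have [] := fdf x.
have [c cst fE] := MVT st (fun x _ => fdf x) cf.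
by rewrite -subr_gt0 fE mulr_gt0 ?subr_gt0// df0.
Qed.

Lemma is_derive_integrating f df (a : R) :
  (forall x : R, is_derive x 1 f (df x)) -> forall x : R,
  is_derive x 1 (fun x => expR (a * x) * f x) (expR (a * x) * (df x + a * f x)).
Proof.
move=> fdf x; have := is_derive_mulr (is_derive_expM a x) (fdf x).
by congr is_derive; ring.
Qed.

(** The hypothesis makes [expR (a * x) * f x] nondecreasing. Most inequalities between transition
    probabilities are proved this way, with [f] the difference of the two sides. *)
Lemma linear_ode_ge0 f df (a t : R) :
  (forall x : R, is_derive x 1 f (df x)) -> 0 <= f 0 -> 0 <= t ->
  (forall x : R, 0 < x < t -> 0 <= df x + a * f x) -> 0 <= f t.
Proof.
move=> fdf f0 t0 h.
have := ge0_is_derive_le (is_derive_integrating a fdf) t0.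
rewrite mulr0 expR0 mul1r => /(_ _)/(le_trans f0).
rewrite pmulr_rge0 ?expR_gt0//; apply => x xt.
by rewrite mulr_ge0 ?expR_ge0// h.
Qed.

Lemma linear_ode_gt0 f df (a t : R) :
  (forall x : R, is_derive x 1 f (df x)) -> 0 <= f 0 -> 0 < t ->
  (forall x : R, 0 < x < t -> 0 < df x + a * f x) -> 0 < f t.
Proof.
move=> fdf f0 t0 h.
have := gt0_is_derive_lt (is_derive_integrating a fdf) t0.
rewrite mulr0 expR0 mul1r => /(_ _)/(le_lt_trans f0).
rewrite pmulr_rgt0 ?expR_gt0//; apply => x xt.
by rewrite mulr_gt0 ?expR_gt0// h.
Qed.

Lemma linear_ode_eq0 f df (a t : R) :
  (forall x : R, is_derive x 1 f (df x)) -> f 0 = 0 ->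
  (forall x : R, df x + a * f x = 0) -> f t = 0.
Proof.
move=> fdf f0 h.
have := @is_derive_0_is_cst _ (fun x => expR (a * x) * f x) 0 t.
move=> /(_ _)/wrap[].
  by move=> x; have := is_derive_integrating a fdf x; rewrite h mulr0.
move=> /esym/eqP; rewrite f0 mulr0 mulf_eq0 expR_eq0.
by move/eqP.
Qed.

(* If [f t < 0] then [expR (- a * x) * f x], which is nonincreasing, forces
   exponential growth of [- f]. *)
Lemma bounded_ode_ge0 f df (a C t : R) : 0 < a ->
  (forall x : R, is_derive x 1 f (df x)) ->
  (forall x : R, 0 <= x -> `|f x| <= C) ->
  (forall x : R, 0 <= x -> df x <= a * f x) -> 0 <= t -> 0 <= f t.
Proof.
move=> a0 fdf fC h t0; rewrite leNgt; apply/negP => ft.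
have C0 : 0 <= C by apply: le_trans (fC _ t0).
pose s := t + C / (- f t) / a.
have ts : t <= s.
  by rewrite lerDl; apply: divr_ge0; [apply: divr_ge0; lra|exact: ltW].
have d1 (x : R) : is_derive x 1 (fun x => - (expR (- a * x) * f x))
    (- (expR (- a * x) * (df x + (- a) * f x))).
  exact: is_deriveN (is_derive_integrating (- a) fdf x).
have := ge0_is_derive_le d1 ts.
rewrite lerN2 => /(_ _)/wrap[].
  move=> x /andP[tx _]; rewrite oppr_ge0 mulr_ge0_le0 ?expR_ge0//.
  by have := h x (le_trans t0 (ltW tx)); lra.
have -> : - a * t = - a * s + a * (s - t) by ring.
have -> : a * (s - t) = C / (- f t).
  by rewrite /s; field; lra.
rewrite expRD -mulrA ler_pM2l ?expR_gt0// => fs.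
have he := expR_ge1Dx (C / (- f t)).
have := fC s (le_trans t0 ts); rewrite ler_norml => /andP[+ _].
have : (1 + C / - f t) * - f t <= expR (C / - f t) * - f t.
  by rewrite ler_pM2r//; lra.
by rewrite mulrDl mul1r divfK ?oppr_eq0 ?lt_eqF//; lra.
Qed.

Lemma bernoulli (x : R) k : -1 <= x -> 1 + k%:R * x <= (1 + x) ^+ k.
Proof.
move=> x1; elim: k => [|k IH]; first by rewrite mul0r addr0 expr0.
have x10 : 0 <= 1 + x by lra.
apply: le_trans (_ : (1 + x) * (1 + k%:R * x) <= _); last first.
  by rewrite exprS ler_wpM2l.
rewrite -subr_ge0 -natr1.
have -> : (1 + x) * (1 + k%:R * x) - (1 + (k%:R + 1) * x) = k%:R * x ^+ 2 by ring.
by rewrite mulr_ge0// sqr_ge0.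
Qed.

End Comparison.

(** * Logarithmic derivatives of passage probabilities *)

(* [q k t] is the probability that a pure birth process started at 1, with
   birth rate [a k] at [k], has made at least [k] jumps by time [t]. *)
Section BirthProcess.
Variables (R : realType) (a : nat -> R) (q : nat -> R -> R).
Implicit Types s t x c lam : R.
Hypothesis a_gt0 : forall k, (0 < k)%N -> 0 < a k.
Hypothesis q0 : forall t, q 0 t = 1.
Hypothesis qS0 : forall k, q k.+1 0 = 0.
Hypothesis dq_qS : forall k (x : R),
  is_derive x 1 (q k.+1) (a k.+1 * (q k x - q k.+1 x)).

Let dq k (x : R) := if k is k'.+1 then a k * (q k' x - q k x) else 0.
Let ddq k (x : R) := if k is k'.+1 then a k * (dq k' x - dq k x) else 0.

Let q_derive k (x : R) : is_derive x 1 (q k) (dq k x).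
Proof.
case: k => [|k]; last exact: dq_qS.
have -> : q 0 = cst 1 by apply/funext => t; rewrite q0.
exact: is_derive_cst.
Qed.

Let dq_derive k (x : R) : is_derive x 1 (dq k) (ddq k x).
Proof.
case: k => [|k]; first exact: is_derive_cst.
have := is_derive_mulr (is_derive_cst (a k.+1) x 1)
  (is_deriveB (q_derive k x) (q_derive k.+1 x)).
by congr is_derive; rewrite mul0r add0r.
Qed.

Lemma birth_ge0 k t : 0 <= t -> 0 <= q k t.
Proof.
elim: k t => [|k IH] t t0; first by rewrite q0.
apply: (@linear_ode_ge0 _ _ _ (a k.+1) _ (q_derive k.+1)) => //.
  by rewrite qS0.
move=> x /andP[x0 _]; rewrite /= -mulrDr subrK.
by rewrite mulr_ge0 ?(ltW (a_gt0 _))// IH// ltW.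
Qed.

Lemma birth_gt0 k t : 0 < t -> 0 < q k t.
Proof.
elim: k t => [|k IH] t t0; first by rewrite q0.
apply: (@linear_ode_gt0 _ _ _ (a k.+1) _ (q_derive k.+1)) => //.
  by rewrite qS0.
move=> x /andP[x0 _]; rewrite /= -mulrDr subrK.
by rewrite mulr_gt0 ?a_gt0// IH.
Qed.

(** The derivatives solve the same forward system as the [q k]. This gives monotonicity in time and,
    through the forward equation, in [k]. *)
Let dq_ge0 k t : 0 <= t -> 0 <= dq k t.
Proof.
elim: k t => [//|k IH] t t0.
apply: (@linear_ode_ge0 _ _ _ (a k.+1) _ (dq_derive k.+1)) => //.
  by rewrite /= qS0 subr0 mulr_ge0 ?(ltW (a_gt0 _))// birth_ge0.
move=> x /andP[x0 _]; rewrite /= -mulrDr subrK.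
by rewrite mulr_ge0 ?(ltW (a_gt0 _))// IH// ltW.
Qed.

Lemma birth_leS k t : 0 <= t -> q k.+1 t <= q k t.
Proof.
move=> /(dq_ge0 k.+1); rewrite /= pmulr_rge0 ?a_gt0//.
by rewrite subr_ge0.
Qed.

Lemma birth_le1 k t : 0 <= t -> q k t <= 1.
Proof.
move=> t0; elim: k => [|k IH]; first by rewrite q0.
exact: le_trans (birth_leS _ t0) IH.
Qed.

Lemma birth_nondecreasing k s t : 0 <= s -> s <= t -> q k s <= q k t.
Proof.
move=> s0 st; apply: (ge0_is_derive_le (q_derive k) st) => x /andP[sx _].
by rewrite dq_ge0// (le_trans s0)// ltW.
Qed.

(** Equivalently [q k t / t ^+ k] is nonincreasing: the growth near 0 is the fastest. *)
Let dq_upper k t : 0 <= t -> t * dq k t <= k%:R * q k t.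
Proof.
elim: k t => [|k IH] t t0; first by rewrite mulr0 mul0r.
rewrite -subr_ge0.
pose f x := k.+1%:R * q k.+1 x - x * dq k.+1 x.
pose df x := k.+1%:R * dq k.+1 x - (dq k.+1 x + x * ddq k.+1 x).
have fdf (x : R) : is_derive x 1 f (df x).
  have h1 := is_derive_mulr (is_derive_cst (k.+1%:R : R) x 1) (q_derive k.+1 x).
  have h2 := is_derive_mulr (is_derive_id x 1) (dq_derive k.+1 x).
  by have := is_deriveB h1 h2; congr is_derive; rewrite mul0r add0r mul1r.
apply: (@linear_ode_ge0 _ f df (a k.+1) _ fdf) => //.
  by rewrite /f qS0 mulr0 mul0r subr0.
move=> x /andP[/ltW x0 _].
have -> : df x + a k.+1 * f x =
    a k.+1 * (k%:R * q k x - x * dq k x) + a k.+1 * q k.+1 x.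
  by rewrite /df /f /= -natr1; ring.
by rewrite addr_ge0// mulr_ge0 ?(ltW (a_gt0 _)) ?birth_ge0 ?subr_ge0 ?IH.
Qed.

(** Modelled on [t ^ k * exp (- c * t)], whose logarithmic derivative is [k / t - c]. *)
Let dq_lower c k t : (forall j, (0 < j <= k)%N -> a j <= c) -> 0 <= c ->
  0 <= t -> (k%:R - c * t) * q k t <= t * dq k t.
Proof.
move=> + c0; elim: k t => [|k IH] t ac t0.
  by rewrite mulr0 q0 mulr1 sub0r oppr_le0 mulr_ge0.
rewrite -subr_ge0.
pose f x := x * dq k.+1 x - (k.+1%:R - c * x) * q k.+1 x.
pose df x := (dq k.+1 x + x * ddq k.+1 x) -
  (- c * q k.+1 x + (k.+1%:R - c * x) * dq k.+1 x).
have fdf (x : R) : is_derive x 1 f (df x).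
  have h2 := is_derive_mulr (is_derive_id x 1) (dq_derive k.+1 x).
  have h3 := is_derive_mulr (is_derive_cst c x 1) (is_derive_id x 1).
  have h4 : is_derive x 1 (fun x : R => k.+1%:R - c * x) (- c).
    have := is_deriveB (is_derive_cst (k.+1%:R : R) x 1) h3.
    by congr is_derive; rewrite mul0r mulr1 !add0r.
  have := is_deriveB h2 (is_derive_mulr h4 (q_derive k.+1 x)).
  by congr is_derive; rewrite /df mul1r.
apply: (@linear_ode_ge0 _ f df (a k.+1) _ fdf) => //.
  by rewrite /f qS0 mulr0 mul0r subr0.
move=> x /andP[/ltW x0 _].
have -> : df x + a k.+1 * f x =
    a k.+1 * (x * dq k x - (k%:R - c * x) * q k x) + (c - a k.+1) * q k.+1 x.
  by rewrite /df /f /= -natr1; ring.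
have acS : a k.+1 <= c by rewrite ac//=.
rewrite addr_ge0// mulr_ge0 ?(ltW (a_gt0 _)) ?birth_ge0 ?subr_ge0// IH//.
by move=> j /andP[j0 jk]; rewrite ac// j0 ltnW.
Qed.

(** With [f] the defect at [k.+1], [f' + a k.+1 * f] is [a k.+1] times the defect at [k]; so one
    bound [lam] serves all later levels, however large their rates. *)
Let dq_propagate k0 l lam t : 0 <= t ->
  (forall s, 0 <= s <= t -> lam * q k0 s <= dq k0 s) ->
  forall s, 0 <= s <= t -> lam * q (k0 + l)%N s <= dq (k0 + l)%N s.
Proof.
move=> t0 h0; elim: l => [|l IH] s /andP[s0 st].
  by rewrite addn0 h0// s0.
rewrite addnS; set k := (k0 + l)%N in IH *; rewrite -subr_ge0.
pose f x := dq k.+1 x - lam * q k.+1 x.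
pose df x := ddq k.+1 x - lam * dq k.+1 x.
have fdf (x : R) : is_derive x 1 f (df x).
  have h1 := is_derive_mulr (is_derive_cst lam x 1) (q_derive k.+1 x).
  have := is_deriveB (dq_derive k.+1 x) h1.
  by congr is_derive; rewrite mul0r add0r.
apply: (@linear_ode_ge0 _ f df (a k.+1) _ fdf) => //.
  rewrite /f /= qS0 mulr0 !subr0 mulr_ge0 ?(ltW (a_gt0 _)) ?birth_ge0//.
move=> x /andP[/ltW x0 /ltW xs].
have -> : df x + a k.+1 * f x = a k.+1 * (dq k x - lam * q k x).
  by rewrite /df /f /=; ring.
by rewrite mulr_ge0 ?(ltW (a_gt0 _))// subr_ge0 IH// x0 (le_trans xs).
Qed.

(* The lower bound [k0 / t - c] on the logarithmic derivative of [q k0] is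
   inherited by all later [q k]. *)
Lemma birth_ratio c k0 k lam t : 0 < t -> (k0 <= k)%N -> 0 <= c -> 0 <= lam ->
  (forall j, (0 < j <= k0)%N -> a j <= c) -> (lam + c) * t <= k0%:R ->
  lam * q k.+1 t <= a k.+1 * (q k t - q k.+1 t).
Proof.
move=> t0 k0k c0 lam0 ac h.
have := @dq_propagate k0 (k.+1 - k0) lam t (ltW t0).
rewrite subnKC; last exact: leqW.
move=> /(_ _)/wrap[]; last by move/(_ t); apply; rewrite lexx ltW.
move=> s /andP[]; rewrite le_eqVlt => /predU1P[<- _|s0 st].
  case: (k0) => [|k1] in h *; last by rewrite qS0 mulr0 dq_ge0.
  by move: h; rewrite pmulr_lle0// => h; rewrite q0 mulr1 /= ; lra.
have := @dq_lower c k0 s ac c0 (ltW s0).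
have hs : lam * s <= k0%:R - c * s.
  by rewrite lerBrDr -mulrDl (le_trans _ h)// ler_wpM2l// addr_ge0.
have := ler_wpM2r (birth_ge0 k0 (ltW s0)) hs.
move=> /le_trans/[apply]; rewrite (mulrC lam) -mulrA ler_pM2l//.
Qed.

Lemma birth_power_le k s t : 0 < s -> s <= t ->
  q k t * s ^+ k <= q k s * t ^+ k.
Proof.
move=> s0 st; have t0 : 0 < t by apply: lt_le_trans st.
(* The substitution [t = s * exp x] turns [t ^- k] into an exponential in [x]; the sign of the
   derivative is then [dq_upper]. *)
pose g x := s * expR (1 * x).
have gE (x : R) : is_derive x 1 g (g x).
  have := is_derive_mulr (is_derive_cst s x 1) (is_derive_expM 1 x).
  by congr is_derive; rewrite mul0r add0r mul1r.
pose f x := - (q k (g x) * expR (- k%:R * x)).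
pose df x := - ((dq k (g x) * g x) * expR (- k%:R * x) +
   q k (g x) * (- k%:R * expR (- k%:R * x))).
have fdf (x : R) : is_derive x 1 f (df x).
  have h := @is_derive1_comp _ (q k) g x _ _ (q_derive k _) (gE x).
  have := is_deriveN (is_derive_mulr h (is_derive_expM (- k%:R) x)).
  by congr is_derive; rewrite /df.
have l0 : 0 <= ln (t / s) by rewrite ln_ge0// ler_pdivlMr// mul1r.
have g0E : g 0 = s by rewrite /g mulr0 expR0 mulr1.
have el : expR (ln (t / s)) = t / s by rewrite lnK// posrE divr_gt0.
have glE : g (ln (t / s)) = t by rewrite /g mul1r el mulrC divfK ?gt_eqF.
have ekl : expR (- k%:R * ln (t / s)) = s ^+ k / t ^+ k.
  by rewrite mulNr expRN expRM_natl el exprMn exprVn invfM invrK mulrC.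
have := ge0_is_derive_le fdf l0.
rewrite /f g0E glE lerN2 ekl mulr0 expR0 mulr1 mulrA ler_pdivrMr ?exprn_gt0//.
apply => x _; rewrite /df oppr_ge0.
have -> : dq k (g x) * g x * expR (- k%:R * x) +
    q k (g x) * (- k%:R * expR (- k%:R * x)) =
    (g x * dq k (g x) - k%:R * q k (g x)) * expR (- k%:R * x) by ring.
rewrite mulr_le0_ge0 ?expR_ge0// subr_le0 dq_upper//.
by rewrite mulr_ge0 ?expR_ge0 ?ltW.
Qed.

End BirthProcess.

(** * Exponential sums and positivity of their expectations *)

(* A list [s] of pairs (coefficient, rate) stands for the exponential sum
   [ev s : t |-> \sum c * exp (- mu * t)]; replacing [exp (- mu * t)] by the
   Laplace transform [g mu] of a random time [T] gives [lap g s], the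
   expectation of [ev s T]. *)
Section ExpSums.
Variable R : realType.
Implicit Types (s : seq (R * R)) (g : R -> R) (t mu c : R).

Definition lap g s : R := \sum_(x <- s) x.1 * g x.2.
Definition ev s t : R := lap (fun mu => expR (- mu * t)) s.
Definition es_der s := [seq (- x.2 * x.1, x.2) | x <- s].
Definition es_scale c s := [seq (c * x.1, x.2) | x <- s].
Definition es_mul s s' := [seq (x.1 * y.1, x.2 + y.2) | x <- s, y <- s'].
Definition es_one : seq (R * R) := [:: (1, 0)].
Definition stable s := all (fun x => 0 <= x.2) s.

Lemma lap_nil g : lap g [::] = 0. Proof. exact: big_nil. Qed.

Lemma lap_cons g x s : lap g (x :: s) = x.1 * g x.2 + lap g s.
Proof. exact: big_cons. Qed.

Lemma lap_cat g s s' : lap g (s ++ s') = lap g s + lap g s'.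
Proof. exact: big_cat. Qed.

Lemma lap_scale g c s : lap g (es_scale c s) = c * lap g s.
Proof.
rewrite /lap big_map big_distrr; apply: eq_bigr => x _ /=.
by rewrite mulrA.
Qed.

Lemma ev_cat s s' t : ev (s ++ s') t = ev s t + ev s' t.
Proof. exact: lap_cat. Qed.

Lemma ev_scale c s t : ev (es_scale c s) t = c * ev s t.
Proof. exact: lap_scale. Qed.

Lemma ev_one t : ev es_one t = 1.
Proof. by rewrite /ev lap_cons lap_nil oppr0 mul0r expR0 mulr1 addr0. Qed.

Lemma ev_der_one t : ev (es_der es_one) t = 0.
Proof. by rewrite /ev lap_cons lap_nil oppr0 !mul0r addr0. Qed.

Lemma ev_der_cat s s' t :
  ev (es_der (s ++ s')) t = ev (es_der s) t + ev (es_der s') t.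
Proof. by rewrite /es_der map_cat ev_cat. Qed.

Lemma ev_der_scale c s t : ev (es_der (es_scale c s)) t = c * ev (es_der s) t.
Proof.
rewrite /es_der /es_scale -map_comp /ev /lap !big_map big_distrr.
by apply: eq_bigr => x _ /=; ring.
Qed.

Lemma ev_mul s s' t : ev (es_mul s s') t = ev s t * ev s' t.
Proof.
rewrite /ev /lap big_allpairs_dep big_distrl; apply: eq_bigr => x _ /=.
rewrite big_distrr; apply: eq_bigr => y _ /=.
by rewrite opprD mulrDl expRD; ring.
Qed.

Lemma ev_der_mul s s' t : ev (es_der (es_mul s s')) t =
  ev (es_der s) t * ev s' t + ev s t * ev (es_der s') t.
Proof.
rewrite /ev /lap !big_map big_allpairs_dep !big_distrl -big_split.
apply: eq_bigr => x _ /=.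
rewrite !big_distrr -big_split; apply: eq_bigr => y _ /=.
have -> : - (x.2 + y.2) * t = - x.2 * t + - y.2 * t by ring.
by rewrite expRD; ring.
Qed.

Lemma stable_cat s s' : stable (s ++ s') = stable s && stable s'.
Proof. exact: all_cat. Qed.

Lemma stable_scale c s : stable (es_scale c s) = stable s.
Proof. exact: all_map. Qed.

Lemma stable_der s : stable (es_der s) = stable s.
Proof. exact: all_map. Qed.

Lemma stable_mul s s' : stable s -> stable s' -> stable (es_mul s s').
Proof.
move=> hs hs'; apply/allP => z zin.
have /allpairsP[[x y] [/= xs ys ->]] := zin.
by rewrite addr_ge0//; [exact: (allP hs) _ xs|exact: (allP hs') _ ys].
Qed.

Lemma ev_is_derive s (t : R) : is_derive t 1 (ev s) (ev (es_der s) t).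
Proof.
elim: s => [|x s IH].
  have -> : ev [::] = cst 0 by apply/funext => u; rewrite /ev lap_nil.
  exact: is_derive_cst.
have h := is_derive_mulr (is_derive_cst x.1 t 1) (is_derive_expM (- x.2) t).
have -> : ev (x :: s) = (fun u => x.1 * expR (- x.2 * u)) + ev s.
  by apply/funext => u; rewrite /ev lap_cons.
apply: (is_derive_eq (is_deriveD h IH)).
by rewrite /ev /= lap_cons /= mul0r add0r; congr (_ + _); ring.
Qed.

Lemma ev_bounded s t : stable s -> 0 <= t ->
  `|ev s t| <= \sum_(x <- s) `|x.1|.
Proof.
move=> + t0; rewrite /ev; elim: s => [|x s IH] /=.
  by rewrite lap_nil big_nil normr0.
move=> /andP[x0 /IH h]; rewrite lap_cons big_cons.
apply: le_trans (ler_normD _ _) _; rewrite lerD// normrM ler_piMr//.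
by rewrite ger0_norm ?expR_ge0// expR_le1 mulNr oppr_le0 mulr_ge0.
Qed.

(** Averages over one holding time: [f t] becomes the expectation of [f (t + X)], with [X]
    exponential of rate [r]. *)
Let lap_exp r s := [seq (x.1 * (r / (r + x.2)), x.2) | x <- s].

(** The average [g] is bounded and solves [g' = r * (g - ev s)], which determines its sign without
    integration. *)
Let ev_lap_exp_ge0 r s : 0 < r -> stable s ->
  (forall t, 0 <= t -> 0 <= ev s t) ->
  forall t, 0 <= t -> 0 <= ev (lap_exp r s) t.
Proof.
move=> r0 st h t t0.
have st' : stable (lap_exp r s) by rewrite /stable all_map.
apply: (bounded_ode_ge0 r0 (ev_is_derive _) _ _ t0).
  by move=> x x0; exact: ev_bounded.
move=> x x0; rewrite -subr_ge0.
have -> : r * ev (lap_exp r s) x - ev (es_der (lap_exp r s)) x = r * ev s x.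
  rewrite /ev /lap !big_map !big_distrr -sumrB.
  rewrite !big_seq; apply: eq_bigr => y /(allP st) y0 /=.
  have : r + y.2 != 0 by rewrite gt_eqF// ltr_wpDr.
  by move=> ?; field.
by rewrite mulr_ge0 ?h// ltW.
Qed.

(** The product is the Laplace transform of a sum of independent exponential times; they are
    averaged out one by one, down to evaluation at time 0. *)
Lemma lap_prod_ge0 (rs : seq R) s : (forall r, r \in rs -> 0 < r) ->
  stable s -> (forall t, 0 <= t -> 0 <= ev s t) ->
  0 <= lap (fun mu => \prod_(r <- rs) (r / (r + mu))) s.
Proof.
elim: rs s => [|r rs IH] s rs0 st h.
  have := h 0 (lexx _); congr (_ <= _); apply: eq_bigr => x _.
  by rewrite mulr0 expR0 big_nil.
have r0 : 0 < r by rewrite rs0// mem_head.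
have -> : lap (fun mu => \prod_(r <- r :: rs) (r / (r + mu))) s =
    lap (fun mu => \prod_(r <- rs) (r / (r + mu))) (lap_exp r s).
  rewrite /lap big_map; apply: eq_bigr => x _ /=.
  by rewrite big_cons mulrA.
apply: IH.
- by move=> u us; rewrite rs0// inE us orbT.
- by rewrite /stable all_map.
- exact: ev_lap_exp_ge0.
Qed.

Lemma lap_flatten (I : Type) (r : seq I) (F : I -> seq (R * R)) g :
  lap g (flatten [seq F i | i <- r]) = \sum_(i <- r) lap g (F i).
Proof.
elim: r => [|i r IH] /=; first by rewrite lap_nil big_nil.
by rewrite lap_cat big_cons IH.
Qed.

(* The solution of [y' = r (ev s - y)], [y 0 = 0]. *)
Definition es_solve r s := (- \sum_(x <- s) x.1 * (r / (r - x.2)), r) ::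
  [seq (x.1 * (r / (r - x.2)), x.2) | x <- s].

Lemma ev_solve0 r s : ev (es_solve r s) 0 = 0.
Proof.
rewrite /ev lap_cons mulr0 expR0 mulr1 /lap big_map /= addrC.
apply/eqP; rewrite subr_eq0; apply/eqP; apply: eq_bigr => x _ /=.
by rewrite mulr0 expR0 mulr1.
Qed.

Lemma ev_der_solve r s t : (forall x, x \in s -> r != x.2) ->
  ev (es_der (es_solve r s)) t = r * (ev s t - ev (es_solve r s) t).
Proof.
move=> rs; rewrite /ev /= !lap_cons /=.
set A := \sum_(x <- s) _; set E := expR _.
have -> : r * (lap (fun mu => expR (- mu * t)) s - (- A * E +
    lap (fun mu => expR (- mu * t)) [seq (x.1 * (r / (r - x.2)), x.2) | x <- s]))
  = - r * - A * E + r * (lap (fun mu => expR (- mu * t)) s -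
    lap (fun mu => expR (- mu * t)) [seq (x.1 * (r / (r - x.2)), x.2) | x <- s]).
  by ring.
congr (_ + _); rewrite /lap !big_map -sumrB big_distrr /=.
rewrite !big_seq; apply: eq_bigr => y /rs ry /=.
have : r - y.2 != 0 by rewrite subr_eq0.
by move=> ?; field.
Qed.

End ExpSums.

(** * Laplace transform of the explosion time *)

Section Rates.
Variables (R : realType) (alpha : R).
Hypothesis alpha_gt1 : 1 < alpha.
Implicit Types (s : seq (R * R)) (t mu c : R) (k l m : nat).

Definition rate k : R := k%:R `^ alpha.

Let alpha_gt0 : 0 < alpha. Proof. by apply: lt_trans alpha_gt1. Qed.

Lemma rate_gt0 k : (0 < k)%N -> 0 < rate k.
Proof. by move=> k0; rewrite powR_gt0// ltr0n. Qed.

Lemma rate_lt k l : (k < l)%N -> rate k < rate l.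
Proof. by move=> kl; rewrite gt0_ltr_powR ?nnegrE// ltr_nat. Qed.

Lemma rate_le k l : (k <= l)%N -> rate k <= rate l.
Proof. by move=> kl; rewrite ge0_ler_powR ?nnegrE ?(ltW alpha_gt0)// ler_nat. Qed.

Definition tail_const : R := alpha / (alpha - 1).

Lemma tail_const_gt0 : 0 < tail_const.
Proof. by rewrite divr_gt0// subr_gt0. Qed.

(** Integral comparison in telescoping form: the right-hand side is the integral of [x ^ (- alpha)]
    over [[k, k + 1]]. *)
Let inv_rate_step k : (0 < k)%N ->
  (rate k.+1)^-1 <= (k%:R `^ (1 - alpha) - k.+1%:R `^ (1 - alpha)) / (alpha - 1).
Proof.
move=> k0; have a1 : 0 < alpha - 1 by rewrite subr_gt0.
have k0R : (0 : R) < k%:R by rewrite ltr0n.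
have kS0R : (0 : R) < k.+1%:R by rewrite ltr0n.
rewrite ler_pdivlMr//.
have -> : (k%:R : R) = k.+1%:R * (k%:R / k.+1%:R).
  by rewrite mulrC divfK// gt_eqF.
have r0 : (0 : R) < k%:R / k.+1%:R by rewrite divr_gt0.
rewrite (powRM _ (ltW kS0R) (ltW r0)) -{2}(mulr1 (k.+1%:R `^ _)) -mulrBr.
have -> : (rate k.+1)^-1 = k.+1%:R `^ (1 - alpha) / k.+1%:R.
  rewrite -(@powR_inv1 _ k.+1%:R)// -powRD; last by rewrite (gt_eqF kS0R) implybT.
  by rewrite /rate -powRN; congr (_ `^ _); ring.
rewrite -mulrA ler_pM2l ?powR_gt0//.
have : 1 + (1 - alpha) * ln (k%:R / k.+1%:R) <= (k%:R / k.+1%:R) `^ (1 - alpha).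
  by rewrite -[X in _ <= X]lnK ?posrE ?powR_gt0// ln_powR expR_ge1Dx.
have : ln (k%:R / k.+1%:R : R) <= - (k.+1%:R)^-1.
  have -> : - (k.+1%:R)^-1 = k%:R / k.+1%:R - 1 :> R.
    by rewrite -natr1; field; rewrite natr1 gt_eqF.
  rewrite -{1}(subrKC 1 (k%:R / k.+1%:R)) le_ln1Dx//.
  by rewrite ltrBrDr addNr.
move=> h1 h2.
have : (alpha - 1) * ln (k%:R / k.+1%:R) <= (alpha - 1) * - k.+1%:R^-1.
  by rewrite ler_pM2l.
move: h2; move: (k.+1%:R^-1) (_ `^ (1 - alpha)) (ln _) => i X L h2 h3; lra.
Qed.

Lemma sum_inv_rate_le k d : (0 < k)%N ->
  \sum_(l < d) (rate (k + l))^-1 <= tail_const * k%:R `^ (1 - alpha).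
Proof.
move=> k0; have a1 : 0 < alpha - 1 by rewrite subr_gt0.
case: d => [|d].
  by rewrite big_ord0 mulr_ge0 ?powR_ge0// ltW// tail_const_gt0.
rewrite big_ord_recl addn0.
have h1 : (rate k)^-1 <= k%:R `^ (1 - alpha).
  by rewrite -powRN ler_powR ?ler1n//; lra.
have h2 : \sum_(l < d) (rate (k + lift ord0 l))^-1 <=
    (k%:R `^ (1 - alpha) - (k + d)%:R `^ (1 - alpha)) / (alpha - 1).
  elim: d => [|d IH]; first by rewrite big_ord0 addn0 subrr mul0r.
  rewrite big_ord_recr /=.
  have := @inv_rate_step (k + d)%N; rewrite ltn_addr// => /(_ isT) h.
  apply: le_trans (lerD IH _) _; first by rewrite /bump add1n addnS; exact: h.
  by rewrite -mulrDl ler_pM2r ?invr_gt0// addnS; lra.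
apply: le_trans (lerD h1 h2) _.
have p0 : (0 : R) <= (k + d)%:R `^ (1 - alpha) by exact: powR_ge0.
have -> : tail_const = 1 + (alpha - 1)^-1.
  by rewrite /tail_const; field; rewrite gt_eqF.
rewrite (mulrDl 1) mul1r lerD2l mulrC ler_pM2l ?invr_gt0//; lra.
Qed.

Let surv k mu d := \prod_(l < d) (rate (k + l) / (rate (k + l) + mu)).

(* Laplace transform at [mu] of the explosion time of a pure birth process
   started at [k]. *)
Definition explosion k mu : R := limn (surv k mu).

Let factor_ge0 k mu : (0 < k)%N -> 0 <= mu -> 0 <= rate k / (rate k + mu).

move=> k0 mu0; have := rate_gt0 k0 => r0.
by rewrite divr_ge0 ?addr_ge0// ltW.
Qed.

Let factor_le1 k mu : (0 < k)%N -> 0 <= mu -> rate k / (rate k + mu) <= 1.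
Proof.
move=> k0 mu0; have := rate_gt0 k0 => r0.
by rewrite ler_pdivrMr ?mul1r ?lerDl// ltr_wpDr.
Qed.

Let surv_ge0 k mu d : (0 < k)%N -> 0 <= mu -> 0 <= surv k mu d.
Proof. by move=> k0 mu0; apply: prodr_ge0 => l _; rewrite factor_ge0 ?ltn_addr. Qed.

Let surv_noninc k mu : (0 < k)%N -> 0 <= mu ->
  {homo surv k mu : n m / (n <= m)%N >-> m <= n}.
Proof.
move=> k0 mu0; apply/nonincreasing_seqP => d.
rewrite /surv big_ord_recr /= ler_piMr ?surv_ge0 ?factor_le1 ?ltn_addr//.
Qed.

Let surv_cvg k mu : (0 < k)%N -> 0 <= mu -> surv k mu @ \oo --> explosion k mu.
Proof.
move=> k0 mu0; apply: nonincreasing_is_cvgn; first exact: surv_noninc.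
by exists 0 => _ [d _ <-]; rewrite surv_ge0.
Qed.

(** Factors off the first holding time. *)
Lemma explosion_rec k mu : (0 < k)%N -> 0 <= mu ->
  rate k * explosion k.+1 mu = (rate k + mu) * explosion k mu.
Proof.
move=> k0 mu0; have r0 := rate_gt0 k0.
have h : (fun d => surv k mu d.+1) @ \oo -->
    rate k / (rate k + mu) * explosion k.+1 mu.
  have -> : (fun d => surv k mu d.+1) =
      (fun d => rate k / (rate k + mu) * surv k.+1 mu d).
    apply/funext => d; rewrite /surv big_ord_recl addn0; congr (_ * _).
    by apply: eq_bigr => l _; rewrite lift0 addnS.
  by apply: cvgMr; exact: surv_cvg.
have h' : (fun d => surv k mu d.+1) @ \oo --> explosion k mu.
  by rewrite (cvg_shiftS (surv k mu)); exact: surv_cvg.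
have <- := cvg_unique _ h h'; last exact: norm_hausdorff.
by field; rewrite gt_eqF// ltr_wpDr.
Qed.

Lemma explosion_le1 k mu : (0 < k)%N -> 0 <= mu -> explosion k mu <= 1.
Proof.
move=> k0 mu0; have := nonincreasing_cvgn_ge (surv_noninc k0 mu0).
move=> /(_ (cvgP _ (surv_cvg k0 mu0)) 0%N) /le_trans; apply.
by rewrite /surv big_ord0.
Qed.

Lemma explosion0 k : (0 < k)%N -> explosion k 0 = 1.
Proof.
move=> k0; apply/eqP; rewrite eq_le explosion_le1//=.
apply: limr_ge; first exact: cvgP (surv_cvg k0 (lexx _)).
apply: nearW => d; rewrite /surv big1// => l _.
by rewrite addr0 divff// gt_eqF// rate_gt0// ltn_addr.
Qed.

(** Jensen's inequality with a bound on the mean of the explosion time, obtained factor by factor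
    from [1 + x <= exp x]. *)
Lemma explosion_ge_expR k mu : (0 < k)%N -> 0 <= mu ->
  expR (- (mu * (tail_const * k%:R `^ (1 - alpha)))) <= explosion k mu.
Proof.
move=> k0 mu0; apply: limr_ge; first exact: cvgP (surv_cvg k0 mu0).
apply: nearW => d.
apply: (@le_trans _ _ (expR (- (mu * \sum_(l < d) (rate (k + l))^-1)))).
  by rewrite ler_expR lerN2 ler_wpM2l// sum_inv_rate_le.
rewrite mulr_sumr -sumrN expR_sum ler_prod// => l _; rewrite expR_ge0/=.
have r0 : 0 < rate (k + l) by rewrite rate_gt0// ltn_addr.
have -> : rate (k + l) / (rate (k + l) + mu) = (1 + mu / rate (k + l))^-1.
  field; rewrite gt_eqF//=.
  by rewrite gt_eqF//= ltr_wpDr.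
rewrite expRN lef_pV2 ?posrE ?expR_gt0//; last first.
  by rewrite ltr_wpDr// divr_ge0// ltW.
exact: expR_ge1Dx.
Qed.

(* Second moment bound: the variance of [exp (- mu T)], [T] the explosion time,
   is at most [explosion k mu ^ 2 * (e - 1)] with [e] the exponential below. *)
Lemma explosion_double k mu : (0 < k)%N -> 0 <= mu ->
  explosion k (2 * mu) <= explosion k mu ^+ 2 *
    expR (mu ^+ 2 / rate k * (tail_const * k%:R `^ (1 - alpha))).
Proof.
move=> k0 mu0; set e := expR _.
have mu20 : 0 <= 2 * mu by rewrite mulr_ge0.
have c1 := surv_cvg k0 mu0; have c2 := surv_cvg k0 mu20.
have c3 : (fun d => surv k mu d ^+ 2 * e) @ \oo --> explosion k mu ^+ 2 * e.
  by apply: cvgMl; rewrite expr2; under eq_fun do rewrite expr2; exact: cvgM.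
apply: ler_cvg_to c2 c3 _.
apply: nearW => d.
have se : expR (\sum_(l < d) (mu / rate (k + l)) ^+ 2) <= e.
  have k0' l : 0 < rate (k + l) by rewrite rate_gt0// ltn_addr.
  rewrite ler_expR; apply: le_trans (_ : mu ^+ 2 / rate k *
      \sum_(l < d) (rate (k + l))^-1 <= _); last first.
    by rewrite ler_wpM2l ?sum_inv_rate_le// divr_ge0 ?sqr_ge0// ltW// rate_gt0.
  rewrite mulr_sumr ler_sum// => l _.
  rewrite exprMn -mulrA ler_wpM2l ?sqr_ge0// expr2 ler_pM2r ?invr_gt0//.
  by rewrite lef_pV2 ?posrE ?k0'// ?(rate_gt0 k0)// rate_le// leq_addr.
apply: (@le_trans _ _ (surv k mu d ^+ 2 *
    expR (\sum_(l < d) (mu / rate (k + l)) ^+ 2))); last first.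
  by rewrite ler_wpM2l// sqr_ge0.
rewrite expR_sum -prodrXl -big_split /= ler_prod// => l _.
have r0 : 0 < rate (k + l) by rewrite rate_gt0// ltn_addr.
rewrite factor_ge0 ?ltn_addr//=.
set a := rate (k + l) in r0 *.
have := expR_ge1Dx ((mu / a) ^+ 2).
have amu : 0 < a + mu by rewrite ltr_wpDr.
have amu2 : 0 < a + 2 * mu by rewrite ltr_wpDr.
(* Cleared of denominators, the two sides differ by [2 * mu ^+ 3]. *)
move=> h; apply: le_trans (_ : (a / (a + mu)) ^+ 2 * (1 + (mu / a) ^+ 2) <= _).
  have -> : (a / (a + mu)) ^+ 2 * (1 + (mu / a) ^+ 2) =
      (a ^+ 2 + mu ^+ 2) / (a + mu) ^+ 2.
    by field; rewrite !gt_eqF.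
  rewrite ler_pdivrMr// mulrAC ler_pdivlMr ?exprn_gt0//.
  rewrite -subr_ge0; have -> : (a ^+ 2 + mu ^+ 2) * (a + 2 * mu) -
    a * (a + mu) ^+ 2 = mu ^+ 3 *+ 2 by ring.
  by rewrite mulrn_wge0// exprn_ge0.
by rewrite ler_wpM2l// sqr_ge0.
Qed.

(** Only the [m] holding times between [m] and [2 * m] are kept, at rates at most [rate (m + m)]. At
    [mu = m ^ (alpha - 1)] the bound is a constant below 1. *)
Lemma explosion_le m mu : (0 < m)%N -> 0 <= mu ->
  explosion m mu <= (1 + m%:R * (mu / rate (m + m)))^-1.
Proof.
move=> m0 mu0; have := nonincreasing_cvgn_ge (surv_noninc m0 mu0).
move=> /(_ (cvgP _ (surv_cvg m0 mu0)) m) /le_trans; apply.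
have r0 : 0 < rate (m + m) by rewrite rate_gt0// ltn_addr.
set x := mu / _; have x0 : 0 <= x by rewrite divr_ge0// ltW.
apply: (@le_trans _ _ (\prod_(l < m) (1 + x)^-1)).
  apply: ler_prod => l _; rewrite factor_ge0 ?ltn_addr//=.
  have rl : 0 < rate (m + l) by rewrite rate_gt0// ltn_addr.
  have -> : rate (m + l) / (rate (m + l) + mu) = (1 + mu / rate (m + l))^-1.
    field; rewrite gt_eqF//=.
    by rewrite gt_eqF//= ltr_wpDr.
  have y0 : 0 <= mu / rate (m + l) by rewrite divr_ge0// ltW.
  have x1 : 0 < 1 + x by rewrite ltr_wpDr.
  have y1 : 0 < 1 + mu / rate (m + l) by rewrite ltr_wpDr.
  rewrite lef_pV2 ?posrE// lerD2l.
  by rewrite ler_wpM2l// lef_pV2 ?posrE// rate_le// leq_add2l ltnW.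
have x1 : 0 < 1 + x by rewrite ltr_wpDr.
have mx1 : 0 < 1 + m%:R * x by rewrite ltr_wpDr// mulr_ge0.
rewrite prodr_const card_ord exprVn lef_pV2 ?posrE ?exprn_gt0//.
by apply: bernoulli; lra.
Qed.

Lemma explosion_cvg mu : 0 <= mu -> explosion ^~ mu @ \oo --> (1 : R).
Proof.
move=> mu0; apply/cvgrPdist_le => e e0.
pose D := mu * tail_const.
have D0 : 0 <= D by rewrite mulr_ge0// ltW// tail_const_gt0.
pose K := expR (ln (e / (D + 1)) / (1 - alpha)).
near=> k.
have k0 : (0 < k)%N by near: k; exact: nbhs_infty_gt.
have kK : K <= k%:R by near: k; exact: nbhs_infty_ger.
rewrite ger0_norm ?subr_ge0 ?explosion_le1// lerBlDr addrC -lerBlDr.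
apply: le_trans (explosion_ge_expR k0 mu0).
apply: le_trans (expR_ge1Dx _); rewrite lerD2l lerN2 mulrA -/D.
have eD : 0 < e / (D + 1) by rewrite divr_gt0// ltr_wpDl.
have h : (k%:R : R) `^ (1 - alpha) <= e / (D + 1).
  rewrite -[X in X <= _]lnK ?posrE ?powR_gt0 ?ltr0n//.
  rewrite -[X in _ <= X]lnK ?posrE// ler_expR ln_powR.
  rewrite mulrC -ler_ndivrMr ?subr_lt0//.
  by rewrite -[X in X <= _]expRK ler_ln ?posrE ?expR_gt0 ?ltr0n.
apply: le_trans (ler_wpM2l D0 h) _.
rewrite mulrCA ler_piMr ?(ltW e0)// ler_pdivrMr ?ltr_wpDl//.
by rewrite mul1r lerDl.
Unshelve. all: by end_near. Qed.

Let lap_cvg (g_ : nat -> R -> R) g s :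
  (forall x, x \in s -> (fun d => g_ d x.2) @ \oo --> g x.2) ->
  (fun d => lap (g_ d) s) @ \oo --> lap g s.
Proof.
elim: s => [|x s IH] h.
  under eq_fun do rewrite lap_nil; rewrite lap_nil; exact: cvg_cst.
under eq_fun do rewrite lap_cons; rewrite lap_cons; apply: cvgD.
  by apply: cvgMr; apply: h; rewrite mem_head.
by apply: IH => y ys; apply: h; rewrite inE ys orbT.
Qed.

(** The explosion time from [k] vanishes as [k] grows; this gives the limit of the harmonic function
    along a run in which only colour 0 still grows. *)
Lemma lap_explosion_cvg s : stable s ->
  (fun k => lap (explosion k) s) @ \oo --> ev s 0.
Proof.
move=> st; apply: lap_cvg => x xs /=.
by rewrite mulr0 expR0; apply: explosion_cvg; exact: (allP st) _ xs.
Qed.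

Lemma lap_explosion_ge0 k s : (0 < k)%N -> stable s ->
  (forall t, 0 <= t -> 0 <= ev s t) -> 0 <= lap (explosion k) s.
Proof.
move=> k0 st h.
have c : (fun d => lap (surv k ^~ d) s) @ \oo --> lap (explosion k) s.
  by apply: lap_cvg => x xs; apply: surv_cvg => //; exact: (allP st) _ xs.
rewrite -(cvg_lim _ c)//; apply: limr_ge; first exact: cvgP c.
apply: nearW => d.
have := @lap_prod_ge0 R [seq rate (k + l) | l <- iota 0 d] s.
move=> /(_ _ st h)/wrap[].
  by move=> _ /mapP[l _ ->]; rewrite rate_gt0// ltn_addr.
congr (_ <= _); apply: eq_bigr => x _; congr (_ * _).
by rewrite big_map -[d in iota 0 d]subn0 big_mkord.
Qed.

Lemma lap_explosion_le k s s' : (0 < k)%N -> stable s -> stable s' ->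
  (forall t, 0 <= t -> ev s t <= ev s' t) ->
  lap (explosion k) s <= lap (explosion k) s'.
Proof.
move=> k0 st st' h; rewrite -subr_ge0 -mulN1r -lap_scale -lap_cat.
apply: lap_explosion_ge0 => //; first by rewrite stable_cat stable_scale st st'.
by move=> t t0; rewrite ev_cat ev_scale mulN1r subr_ge0 h.
Qed.

(** Positivity in both directions: the expectation depends on a list only through the function it
    represents, so lists are exchanged without comparing coefficients. *)
Lemma lap_explosion_eq k s s' : (0 < k)%N -> stable s -> stable s' ->
  (forall t, 0 <= t -> ev s t = ev s' t) ->
  lap (explosion k) s = lap (explosion k) s'.
Proof.
move=> k0 st st' h; apply/eqP; rewrite eq_le.
by rewrite !lap_explosion_le// => t t0; rewrite h.
Qed.

(** [explosion_rec] extended linearly: a jump of colour 0 acts as minus the time derivative. *)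
Lemma lap_explosion_rec k s : (0 < k)%N -> stable s ->
  rate k * (lap (explosion k.+1) s - lap (explosion k) s) =
  - lap (explosion k) (es_der s).
Proof.
move=> k0 st; rewrite /lap big_map -sumrB big_distrr -sumrN /= !big_seq.
apply: eq_bigr => x /(allP st) x0.
by rewrite -mulrBr mulrCA mulrBr explosion_rec//; ring.
Qed.

End Rates.

(** * Transition probabilities and harmonic functions of the urn *)

Section BirthSums.
Variables (R : realType) (alpha : R).
Hypothesis alpha_gt1 : 1 < alpha.
Implicit Types (s : seq (R * R)) (t mu c : R) (k l m j d : nat).
Local Notation rate := (rate alpha).

(* [ev (birth d k) t] is the probability that a pure birth process started at
   [k] makes at least [d] jumps before time [t]. *)
Fixpoint birth d k : seq (R * R) :=
  if d is d'.+1 then es_solve (rate k) (birth d' k.+1) else es_one R.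

(** Keeps the denominators in [es_solve] nonzero: [rate k] differs from 0 and from all rates beyond
    [k]. *)
Let birth_rates d k : (0 < k)%N ->
  forall x, x \in birth d k -> x.2 = 0 \/ rate k <= x.2.
Proof.
elim: d k => [|d IH] k k0 x /=; first by rewrite inE => /eqP ->; left.
rewrite inE => /predU1P[->|/mapP[y yb ->]]; first by right.
have [//|->|h] := IH k.+1 _ y yb; first by left.
by right; rewrite (le_trans _ h)// rate_le.
Qed.

Lemma stable_birth d k : (0 < k)%N -> stable (birth d k).
Proof.
move=> k0; apply/allP => x /birth_rates[//|-> //|]; apply: le_trans.
by rewrite ltW// rate_gt0.
Qed.

Lemma birth_der d k t : (0 < k)%N -> ev (es_der (birth d.+1 k)) t =
  rate k * (ev (birth d k.+1) t - ev (birth d.+1 k) t).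
Proof.
move=> k0; apply: ev_der_solve => x /birth_rates[//|->|h].
  by rewrite gt_eqF// rate_gt0.
by rewrite lt_eqF// (lt_le_trans _ h)// rate_lt.
Qed.

Lemma birth_S0 d k : ev (birth d.+1 k) 0 = 0.
Proof. exact: ev_solve0. Qed.

(** Harmonicity uses the backward equation, built into [birth]; the estimates on passage
    probabilities use this forward one. Its defect [D] solves [D' + rate k * D = 0] with [D 0 = 0],
    by the case of one jump less from [k.+1]. *)
Lemma birth_forward d k t : (0 < k)%N -> ev (es_der (birth d.+1 k)) t =
  rate (k + d) * (ev (birth d k) t - ev (birth d.+1 k) t).
Proof.
elim: d k t => [|d IH] k t k0; first by rewrite addn0 birth_der// !ev_one.
pose D x := ev (es_der (birth d.+2 k)) x -
  rate (k + d.+1) * (ev (birth d.+1 k) x - ev (birth d.+2 k) x).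
pose dD x := ev (es_der (es_der (birth d.+2 k))) x - rate (k + d.+1) *
  (ev (es_der (birth d.+1 k)) x - ev (es_der (birth d.+2 k)) x).
have DdD (x : R) : is_derive x 1 D (dD x).
  have h := is_deriveB (ev_is_derive (birth d.+1 k) x)
                       (ev_is_derive (birth d.+2 k) x).
  have h1 := is_derive_mulr (is_derive_cst (rate (k + d.+1)) x 1) h.
  have := is_deriveB (ev_is_derive (es_der (birth d.+2 k)) x) h1.
  by congr is_derive; rewrite mul0r add0r.
suff : D t = 0 by move/eqP; rewrite subr_eq0 => /eqP.
apply: (@linear_ode_eq0 _ D dD (rate k) t DdD).
  rewrite /D !birth_S0 birth_der// !birth_S0 subrr !mulr0 subrr//.
move=> x; rewrite /D /dD.
have -> : ev (es_der (es_der (birth d.+2 k))) x =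
    rate k * (ev (es_der (birth d.+1 k.+1)) x - ev (es_der (birth d.+2 k)) x).
  have e : ev (es_der (birth d.+2 k)) = (fun y => cst (rate k) y *
      (ev (birth d.+1 k.+1) - ev (birth d.+2 k)) y).
    by apply/funext => y; rewrite birth_der.
  have := ev_is_derive (es_der (birth d.+2 k)) x.
  have h : is_derive x 1 (ev (birth d.+1 k.+1) - ev (birth d.+2 k)) _ :=
    is_deriveB (ev_is_derive (birth d.+1 k.+1) x)
               (ev_is_derive (birth d.+2 k) x).
  have h1 := is_derive_mulr (is_derive_cst (rate k) x 1) h.
  rewrite -e in h1; move=> h2.
  have <- := @derive_val _ _ _ _ _ _ _ h2.
  by rewrite (@derive_val _ _ _ _ _ _ _ h1) mul0r add0r.
rewrite IH// addSnnS.
rewrite !birth_der//; ring.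
Qed.

Definition reach j k := birth (j - k) k.

Lemma ev_reach_ge j k t : (j <= k)%N -> ev (reach j k) t = 1.
Proof. by rewrite /reach -subn_eq0 => /eqP ->; exact: ev_one. Qed.

Lemma ev_reach0 j k : ev (reach j k) 0 = (j <= k)%N%:R.
Proof.
case: (leqP j k) => [jk|kj]; first by rewrite ev_reach_ge.
by rewrite /reach -(subnSK kj) birth_S0.
Qed.

(* The backward equation of the birth process; it says that [ev (u k) t] is the
   expectation at time [t] of a function of the process started at [k]. *)
Definition backward (u : nat -> seq (R * R)) := forall k t, (0 < k)%N ->
  stable (u k) /\
  ev (es_der (u k)) t = rate k * (ev (u k.+1) t - ev (u k) t).

Lemma backward_reach j : backward (reach j).
Proof.
move=> k t k0; split; first exact: stable_birth.
case: (leqP j k) => [jk|kj]; last by rewrite /reach -(subnSK kj) birth_der.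
rewrite !ev_reach_ge ?(leqW jk)// subrr mulr0 /reach.
by move: jk; rewrite -subn_eq0 => /eqP ->; exact: ev_der_one.
Qed.

Lemma backward_one : backward (fun=> es_one R).
Proof.
by move=> k t k0; rewrite ev_der_one subrr mulr0 /stable /= lexx.
Qed.

Lemma backward_add u v : backward u -> backward v ->
  backward (fun k => u k ++ v k).
Proof.
move=> hu hv k t k0; have [u1 u2] := hu k t k0; have [v1 v2] := hv k t k0.
by rewrite stable_cat u1 v1 ev_der_cat u2 v2 !ev_cat; split => //; ring.
Qed.

Lemma backward_scale c u : backward u -> backward (fun k => es_scale c (u k)).
Proof.
move=> hu k t k0; have [u1 u2] := hu k t k0.
by rewrite stable_scale u1 ev_der_scale u2 !ev_scale; split => //; ring.
Qed.

(** Induction downwards from level [K]: the backward equation drives [u k] by [u k.+1]. *)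
Lemma backward_ge0 K u : backward u ->
  (forall k t, (K <= k)%N -> 0 <= t -> 0 <= ev (u k) t) ->
  (forall k, 0 <= ev (u k) 0) ->
  forall k t, (0 < k)%N -> 0 <= t -> 0 <= ev (u k) t.
Proof.
move=> hu hK h0 k t.
have: (K <= k + (K - k))%N by rewrite -leq_subLR.
move: (K - k)%N => d; elim: d k t => [|d IH] k t kd k0 t0.
  by rewrite hK// -(addn0 k).
apply: (@linear_ode_ge0 _ _ _ (rate k) _ (ev_is_derive (u k))) => //.
move=> x /andP[x0 _]; have [_ ->] := hu k x k0.
rewrite -mulrDr subrK mulr_ge0 ?(ltW (rate_gt0 _ _))//.
by rewrite IH ?addSnnS// ltW.
Qed.

Lemma reach_ge0 j k t : (0 < k)%N -> 0 <= t -> 0 <= ev (reach j k) t.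
Proof.
move=> k0; apply: (@backward_ge0 j) k0 => //; first exact: backward_reach.
- by move=> {}k {}t jk t0; rewrite ev_reach_ge.
- by move=> {}k; rewrite ev_reach0.
Qed.

(* Started from [k], expectations of the indicator of [N < K], and of this
   indicator halved at [N = m]. *)
Definition avoid K k := es_one R ++ es_scale (-1) (reach K k).
Definition avoid_half m K k := avoid K k ++
  es_scale (- 2^-1) (reach m k ++ es_scale (-1) (reach m.+1 k)).

Lemma ev_avoid K k t : ev (avoid K k) t = 1 - ev (reach K k) t.
Proof. by rewrite ev_cat ev_one ev_scale mulN1r. Qed.

Lemma ev_avoid_half m K k t : ev (avoid_half m K k) t =
  1 - ev (reach K k) t - (ev (reach m k) t - ev (reach m.+1 k) t) / 2.
Proof. by rewrite ev_cat ev_avoid ev_scale ev_cat ev_scale; ring. Qed.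

Lemma backward_avoid K : backward (avoid K).
Proof.
apply: backward_add; first exact: backward_one.
exact/backward_scale/backward_reach.
Qed.

Lemma backward_avoid_half m K : backward (avoid_half m K).
Proof.
apply: backward_add; first exact: backward_avoid.
apply: backward_scale; apply: backward_add; first exact: backward_reach.
exact/backward_scale/backward_reach.
Qed.

Lemma avoid_ge0 K k t : (0 < k)%N -> 0 <= t -> 0 <= ev (avoid K k) t.
Proof.
move=> k0; apply: (@backward_ge0 K) k0 => //; first exact: backward_avoid.
- by move=> {}k {}t Kk t0; rewrite ev_avoid ev_reach_ge// subrr.
- by move=> {}k; rewrite ev_avoid ev_reach0; case: leqP => _; rewrite ?subrr ?subr0.
Qed.

Lemma avoid_le1 K k t : (0 < k)%N -> 0 <= t -> ev (avoid K k) t <= 1.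
Proof. by move=> k0 t0; rewrite ev_avoid gerBl reach_ge0. Qed.

Lemma ev_avoid_half0 m K k : (m < K)%N -> ev (avoid_half m K k) 0 =
  if (K <= k)%N then 0 else if k == m then 2^-1 else 1.
Proof.
move=> mK; rewrite ev_avoid_half !ev_reach0.
case: (leqP K k) => [Kk|_].
  by rewrite (leq_trans (ltnW mK) Kk) (leq_trans mK Kk) subrr mul0r subrr.
by case: ltngtP => _; rewrite /= ?subrr ?subr0 ?mul0r ?subr0//; lra.
Qed.

Lemma avoid_half_ge0 m K k t : (m < K)%N -> (0 < k)%N -> 0 <= t ->
  0 <= ev (avoid_half m K k) t.
Proof.
move=> mK k0; apply: (@backward_ge0 K) k0 => //.
- exact: backward_avoid_half.
- move=> {}k {}t Kk t0; have mk := leq_trans mK Kk.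
  rewrite ev_avoid_half (ev_reach_ge _ Kk) (ev_reach_ge _ (ltnW mk)).
  by rewrite (ev_reach_ge _ mk) !subrr mul0r subr0.
- move=> {}k; rewrite ev_avoid_half0//; case: ifP => // _.
  by case: ifP => // _; rewrite invr_ge0.
Qed.

Section Product.
Variables (n : nat) (u : nat -> seq (R * R)).
Hypothesis hu : backward u.
Implicit Types (N : 'I_n.+1 -> nat) (r : seq 'I_n.+1).

Definition add_ball N (i : 'I_n.+1) := fun j : 'I_n.+1 => (N j + (j == i))%N.

Lemma add_ball_same N i : add_ball N i i = (N i).+1.
Proof. by rewrite /add_ball eqxx addn1. Qed.

Lemma add_ball_other N i (j : 'I_n.+1) : j != i -> add_ball N i j = N j.
Proof. by rewrite /add_ball => /negbTE ->; rewrite addn0. Qed.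

Definition es_prod r N := foldr (fun i s => es_mul (u (N i)) s) (es_one R) r.

Lemma ev_es_prod r N t : ev (es_prod r N) t = \prod_(i <- r) ev (u (N i)) t.
Proof.
elim: r => [|i r IH]; first by rewrite big_nil ev_one.
by rewrite big_cons /= ev_mul IH.
Qed.

Lemma stable_es_prod r N : (forall i, (0 < N i)%N) -> stable (es_prod r N).
Proof.
move=> N0; elim: r => [|i r IH]; first by rewrite /stable /= lexx.
by apply: stable_mul => //; have [] := hu 0 (N0 i).
Qed.

Lemma add_ball_gt0 N i : (forall j : 'I_n.+1, (0 < N j)%N) ->
  forall j : 'I_n.+1, (0 < add_ball N i j)%N.
Proof. by move=> N0 j; rewrite addn_gt0 N0. Qed.

Lemma ev_der_es_prod r N t : (forall i, (0 < N i)%N) -> uniq r ->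
  ev (es_der (es_prod r N)) t = \sum_(i <- r) rate (N i) *
    (ev (es_prod r (add_ball N i)) t - ev (es_prod r N) t).
Proof.
move=> N0; elim: r => [|x r IH] /=; first by rewrite big_nil ev_der_one.
move=> /andP[xr ur]; rewrite ev_der_mul IH// big_cons /= !ev_mul.
have [_ ->] := hu t (N0 x).
have -> : ev (es_prod r (add_ball N x)) t = ev (es_prod r N) t.
  rewrite !ev_es_prod !big_seq; apply: eq_bigr => i ir.
  by rewrite add_ball_other//; apply: contraNneq xr => <-.
rewrite add_ball_same; congr (_ + _); first by ring.
rewrite big_distrr /= !big_seq; apply: eq_bigr => i ir.
rewrite !ev_mul add_ball_other; first by ring.
by apply: contraNneq xr => ->.
Qed.

Definition others : seq 'I_n.+1 := [seq lift ord0 i | i <- enum 'I_n].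

Lemma big_others (V : Type) (idx : V) (op : Monoid.com_law idx) (F : 'I_n.+1 -> V) :
  \big[op/idx]_(i <- others) F i = \big[op/idx]_(i < n) F (lift ord0 i).
Proof. by rewrite big_map big_enum. Qed.

Definition urn_value N := lap (explosion alpha (N ord0)) (es_prod others N).

(** The urn is the jump chain of the superposed birth processes. Colour 0 contributes minus the
    expectation of the time derivative of the product, the other colours contribute the backward
    expansion of that derivative, and the two cancel. *)
Lemma urn_value_harmonic N : (forall i, (0 < N i)%N) ->
  \sum_(i < n.+1) rate (N i) * (urn_value (add_ball N i) - urn_value N) = 0.
Proof.
move=> N0; rewrite big_ord_recl /urn_value.
have -> : es_prod others (add_ball N ord0) = es_prod others N.
  rewrite /others; elim: (enum _) => //= i r ->.
  by rewrite add_ball_other.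
rewrite add_ball_same lap_explosion_rec// ?stable_es_prod//.
pose F i := es_scale (rate (N i))
  (es_prod others (add_ball N i) ++ es_scale (-1) (es_prod others N)).
have st i : stable (F i).
  by rewrite stable_scale stable_cat stable_scale !stable_es_prod// =>
    *; exact: add_ball_gt0.
have stf : stable (flatten [seq F i | i <- others]).
  by elim: others => [//|i r IH] /=; rewrite stable_cat st IH.
rewrite (@lap_explosion_eq _ _ _ _ (flatten [seq F i | i <- others]))//.
- rewrite lap_flatten big_others addrC; apply/eqP; rewrite subr_eq0; apply/eqP.
  apply: eq_bigr => i _; rewrite lap_scale lap_cat lap_scale mulN1r.
  by rewrite add_ball_other.
- by rewrite stable_der stable_es_prod.
- move=> t t0; rewrite ev_der_es_prod//; last first.
    by rewrite map_inj_uniq ?enum_uniq//; exact: lift_inj.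
  rewrite /ev lap_flatten; apply: eq_bigr => i _.
  by rewrite lap_scale lap_cat lap_scale mulN1r.
Qed.

End Product.

End BirthSums.

Local Open Scope card_scope.

(** * Cardinality of the selection steps in terms of tallies *)

Section Counting.
Variables (b : nat -> bool) (N : nat -> nat).
Hypothesis N_step : forall j, N j.+1 = (N j + b j)%N.
Let S := [set j | b j].

Lemma card_uniq_seq (T : choiceType) (s : seq T) :
  uniq s -> [set` s] #= `I_(size s).
Proof.
move=> us; have -> : [set` s] = [set` [fset x in s]%fset].
  by apply/seteqP; split => x /=; rewrite inE.
by apply/card_eq_fsetP; rewrite card_fseq undup_id.
Qed.

Let N_count j : N j = (N 0 + count b (iota 0 j))%N.
Proof.
elim: j => [|j IH]; first by rewrite addn0.
by rewrite N_step IH -addn1 iotaD count_cat /= add0n addn0 addnA.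
Qed.

Lemma tally_le i j : (i <= j)%N -> (N i <= N j)%N.
Proof.
move=> /subnK <-; elim: (j - i)%N => [//|d IH].
by rewrite addSn N_step (leq_trans IH)// leq_addr.
Qed.

Lemma tally_stationary c : (forall j, (N j <= c)%N) ->
  exists J, forall j, (J <= j)%N -> N j = N J.
Proof.
move=> Nc.
have [J _ JP] : exists2 J, True & forall j, (N j <= N J)%N.
  have ex : exists v, `[< exists j, N j = v >]
    by exists (N 0%N); apply/asboolP; exists 0%N.
  have bd v : `[< exists j, N j = v >] -> (v <= c)%N by move=> /asboolP[j <-].
  case: (ex_maxnP ex bd) => v /asboolP[J <-] h; exists J => // j.
  by apply: h; apply/asboolP; exists j.
by exists J => j Jj; apply/eqP; rewrite eqn_leq JP tally_le.
Qed.

Let prefix_sub j : [set` [seq l <- iota 0 j | b l]] `<=` S.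
Proof. by move=> l /=; rewrite mem_filter => /andP[]. Qed.

Let card_prefix j : [set` [seq l <- iota 0 j | b l]] #= `I_(N j - N 0).
Proof.
have := card_uniq_seq (filter_uniq b (iota_uniq 0 j)).
by rewrite size_filter (N_count j) addKn.
Qed.

Let card_stationary J : (forall j, (J <= j)%N -> N j = N J) ->
  S #= `I_(N J - N 0).
Proof.
move=> h; apply: card_eq_trans (card_prefix J).
suff -> : S = [set` [seq l <- iota 0 J | b l]] by exact: card_eqxx.
apply/seteqP; split; last exact: prefix_sub.
move=> l /= bl; rewrite mem_filter bl mem_iota /= add0n ltnNge.
apply/negP => Jl; have := h l.+1 (leqW Jl); rewrite N_step h// bl.
by lia.
Qed.

(** A tally that never gains [k] is bounded, hence eventually constant, and then [S] is finite with
    fewer than [k] elements. *)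
Lemma card_le_stepsP k : `I_k #<= S <-> exists j, (N 0 + k <= N j)%N.
Proof.
split=> [kS|[j h]].
  apply/not_existsP => h.
  have [J Jst] : exists J, forall j, (J <= j)%N -> N j = N J.
    apply: (@tally_stationary (N 0 + k)) => j.
    by have /negP := h j; rewrite -ltnNge => /ltnW.
  have /negP := h J.
  move: kS; rewrite (card_le_eqr (card_stationary Jst)) card_le_II.
  have := tally_le (leq0n J); lia.
apply: card_le_trans (subset_card_le (@prefix_sub j)).
by rewrite (card_le_eqr (card_prefix j)) card_le_II; lia.
Qed.

Lemma card_eq_stepsP k :
  S #= `I_k <-> exists J, forall j, (J <= j)%N -> N j = (N 0 + k)%N.
Proof.
split=> [Sk|[J h]]; last first.
  have := @card_stationary J; rewrite (h J)// addKn; apply=> j /h //.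
have [J NJ] : exists j, (N 0 + k <= N j)%N.
  by apply/card_le_stepsP; rewrite (card_le_eqr Sk) card_le_II.
have up j : (N j <= N 0 + k)%N.
  rewrite leqNgt; apply/negP => h.
  have : `I_k.+1 #<= S by apply/card_le_stepsP; exists j; rewrite addnS.
  by rewrite (card_le_eqr Sk) card_le_II ltnn.
exists J => j Jj; apply/eqP; rewrite eqn_leq up/=.
by rewrite (leq_trans NJ)// tally_le.
Qed.

End Counting.

Lemma card_le_finset (T : finType) (k : nat) (A : set T) :
  `I_k #<= A <-> (k <= #|[set x | x \in A]%SET|)%N.
Proof.
have e : A = [set` enum [set x | x \in A]%SET].
  by apply/seteqP; split => x /=; rewrite mem_enum !inE.
rewrite {1}e (card_le_eqr (card_uniq_seq (enum_uniq _))) card_le_II -cardE.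
by [].
Qed.

(** * One step of the urn *)

Section UrnSteps.
Variables (R : realType) (alpha : R) (n : nat).
Implicit Types (N : 'I_n.+1 -> nat) (u : R) (i j : 'I_n.+1).

Definition total_rate N := \sum_(k < n.+1) rate alpha (N k).

Let below N i := \sum_(k < n.+1 | (k < i)%N) rate alpha (N k).
Let upto N i := \sum_(k < n.+1 | (k <= i)%N) rate alpha (N k).

Let rate_ge0 k : 0 <= rate alpha k. Proof. exact: powR_ge0. Qed.

Let upto_below N i : upto N i = below N i + rate alpha (N i).
Proof.
rewrite /upto (bigD1 i) //= addrC; congr (_ + _).
by apply: eq_bigl => k; rewrite andbC -ltn_neqAle.
Qed.

Let upto_le_below N i j : (i < j)%N -> upto N i <= below N j.
Proof.
move=> ij; rewrite /upto /below [leRHS](bigID (fun k : 'I_n.+1 => (k <= i)%N)) /=.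
rewrite -[leLHS]addr0 lerD ?sumr_ge0//.
by rewrite le_eqVlt; apply/orP; left; apply/eqP/eq_bigl => k; lia.
Qed.

Let below_ge0 N i : 0 <= below N i. Proof. exact: sumr_ge0. Qed.

Let upto_le_total N i : upto N i <= total_rate N.
Proof.
rewrite /total_rate (bigID (fun k : 'I_n.+1 => (k <= i)%N)) /=.
by rewrite lerDl sumr_ge0.
Qed.

Lemma total_rate_gt0 N : (forall i, (0 < N i)%N) -> 0 < total_rate N.
Proof.
move=> N0; rewrite /total_rate big_ord_recl.
by rewrite ltr_pwDl ?sumr_ge0// rate_gt0.
Qed.

Lemma urn_selectsE N u i : urn_selects alpha N u i =
  (below N i / total_rate N < u <= upto N i / total_rate N).
Proof. by []. Qed.

Lemma urn_selects_inj N u i j : (forall k, (0 < N k)%N) ->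
  urn_selects alpha N u i -> urn_selects alpha N u j -> i = j.
Proof.
move=> /total_rate_gt0 W0.
have h (k l : 'I_n.+1) : (k < l)%N ->
    urn_selects alpha N u k -> urn_selects alpha N u l ->
    False.
  move=> kl /andP[_ uk] /andP[ul _]; have := lt_le_trans ul uk.
  by rewrite ltNge ler_pM2r ?invr_gt0// upto_le_below.
move=> ui uj; have [ij|ji|/val_inj//] := ltngtP i j.
  by case: (h i j ij ui uj).
by case: (h j i ji uj ui).
Qed.

Lemma urn_selects_ex N u : (forall k, (0 < N k)%N) -> 0 < u <= 1 ->
  exists i, urn_selects alpha N u i.
Proof.
move=> /total_rate_gt0 W0 /andP[u0 u1].
have Pmax : u * total_rate N <= upto N ord_max.
  have -> : upto N ord_max = total_rate N.
    by apply: eq_bigl => k; rewrite /= -ltnS ltn_ord.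
  by rewrite ler_piMl// ltW.
case: (@arg_minnP _ ord_max (fun i => u * total_rate N <= upto N i)
  (fun i => nat_of_ord i) Pmax) => i ui imin.
exists i; rewrite urn_selectsE ltr_pdivrMr// ler_pdivlMr// ui andbT.
have [i0|i0] := posnP i.
  have -> : below N i = 0 by rewrite /below big1// => k; rewrite i0.
  by rewrite mulr_gt0.
have i1n : (i.-1 < n.+1)%N by exact: leq_ltn_trans (leq_pred i) (ltn_ord i).
have -> : below N i = upto N (Ordinal i1n).
  by apply: eq_bigl => k /=; lia.
rewrite ltNge; apply/negP => /imin /=; lia.
Qed.

Lemma urn_selects_add N u i : (forall k, (0 < N k)%N) ->
  urn_selects alpha N u i ->
  (fun j => N j + urn_selects alpha N u j)%N = add_ball N i.
Proof.
move=> N0 ui; apply/funext => j; rewrite /add_ball; congr (_ + _)%N.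
case: eqVneq => [->|ji]; first by rewrite ui.
apply/eqP; rewrite eqb0; apply: contraNN ji => uj.
by apply/eqP; exact: (@urn_selects_inj N u).
Qed.

Lemma urn_selects_itv N i : [set u | urn_selects alpha N u i] =
  [set` `](below N i / total_rate N), (upto N i / total_rate N)]].
Proof. by apply/seteqP; split => u /=; rewrite urn_selectsE in_itv. Qed.

Lemma urn_itv_bounds N i : (forall k, (0 < N k)%N) ->
  [/\ 0 <= below N i / total_rate N, upto N i / total_rate N <= 1 &
   upto N i / total_rate N - below N i / total_rate N =
     rate alpha (N i) / total_rate N].
Proof.
move=> /total_rate_gt0 W0; split.
- by rewrite divr_ge0// ltW.
- by rewrite ler_pdivrMr// mul1r upto_le_total.
- by rewrite upto_below; ring.
Qed.

Lemma measurable_urn_selects N i : measurable [set u | urn_selects alpha N u i].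
Proof. by rewrite urn_selects_itv; exact: measurable_itv. Qed.

End UrnSteps.

Section UniformVariable.
Context (R : realType) (d : measure_display) (T : measurableType d)
  (P : probability T R).

Lemma uniform01_itv (X : {RV P >-> R}) (x y : R) :
  uniform01 X -> 0 <= x -> x <= y -> y <= 1 ->
  P (X @^-1` [set` `]x, y]]) = (y - x)%:E.
Proof.
move=> UX x0 xy y1; have := UX _ (measurable_itv `]x, y]).
rewrite /distribution /pushforward => ->.
rewrite /uniform_prob integral_uniform_pdf.
rewrite setIidl; last first.
  by move=> z /=; rewrite !in_itv/= => /andP[xz zy]; lra.
rewrite (eq_integral (fun=> 1%:E)); last first.
  move=> z; rewrite inE /= in_itv /= => /andP[xz zy].
  have z01 : 0 <= (z : R) <= 1 by apply/andP; split; lra.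
  by congr EFin; rewrite /uniform_pdf z01 subr0 invr1.
rewrite integral_cst//= mul1e lebesgue_measure_itv/= lte_fin.
case: ltP => //; rewrite le_eqVlt => /orP[/eqP ->|]; first by rewrite subrr.
by rewrite ltNge xy.
Qed.

Lemma uniform01_urn_selects (alpha : R) n (N : 'I_n.+1 -> nat) i
    (X : {RV P >-> R}) : uniform01 X -> (forall k, (0 < N k)%N) ->
  P (X @^-1` [set u | urn_selects alpha N u i]) =
  (rate alpha (N i) / total_rate alpha N)%:E.
Proof.
move=> UX N0; have [b0 b1 be] := @urn_itv_bounds R alpha n N i N0.
rewrite urn_selects_itv uniform01_itv// ?be//.
by rewrite -subr_ge0 be divr_ge0 ?powR_ge0// ltW// total_rate_gt0.
Qed.

End UniformVariable.

(** * Finite paths and a martingale bound *)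

Section Paths.
Context (R : realType) (alpha : R) (n : nat) (N0 : 'I_n.+1 -> nat)
  (d : measure_display) (T : measurableType d) (P : probability T R).
Hypothesis N0_gt0 : forall i, (0 < N0 i)%N.
Implicit Types (N : 'I_n.+1 -> nat) (c : seq 'I_n.+1) (U : nat -> {RV P >-> R}).

Lemma urn_tally_shift N (u : nat -> R) j : urn_tally alpha N u j.+1 =
  urn_tally alpha (fun i => N i + urn_selects alpha N (u 0%N) i)%N
    (fun k => u k.+1) j.
Proof.
elim: j => [//|j IH].
have -> : urn_tally alpha N u j.+2 = (fun i => urn_tally alpha N u j.+1 i +
  urn_selects alpha (urn_tally alpha N u j.+1) (u j.+1) i)%N by [].
by rewrite IH.
Qed.

(** Splits on the Boolean vector of the colours selected by the first draw, one of finitely many and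
    possibly all false; the induction then runs on the shifted draws. *)
Lemma measurable_urn_tally U N (Q : set ('I_n.+1 -> nat)) j :
  measurable [set w | Q (urn_tally alpha N (fun k => U k w) j)].
Proof.
elim: j U N => [|j IH] U N.
  rewrite /=.
  have [q|nq] := pselect (Q N).
    have -> : [set w : T | Q N] = setT by apply/seteqP; split.
    exact: measurableT.
  have -> : [set w : T | Q N] = set0 by apply/seteqP; split.
  exact: measurable0.
pose C (b : {ffun 'I_n.+1 -> bool}) := \bigcap_(i in [set: 'I_n.+1])
  (U 0%N @^-1` [set u | urn_selects alpha N u i = b i]).
have -> : [set w | Q (urn_tally alpha N (fun k => U k w) j.+1)] =
  \bigcup_(b in [set: {ffun 'I_n.+1 -> bool}])
  (C b `&` [set w | Q (urn_tally alpha (fun i => N i + b i)%N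
    (fun k => U k.+1 w) j)]); last first.
  apply: fin_bigcup_measurable => // b _; apply: measurableI; last exact: IH.
  apply: fin_bigcap_measurable => // i _.
  apply: measurable_funPTI => //.
  case: (b i); first exact: measurable_urn_selects.
  have -> : [set u | urn_selects alpha N u i = false] =
      ~` [set u | urn_selects alpha N u i].
    by apply/seteqP; split => u /=; [move=> ->|move=> /negP/negbTE].
  by apply: measurableC; exact: measurable_urn_selects.
apply/seteqP; split => w; rewrite /mkset urn_tally_shift.
  move=> Qw; exists [ffun i => urn_selects alpha N (U 0%N w) i] => //; split.
    by move=> i _ /=; rewrite ffunE.
  rewrite /mkset; suff -> : (fun i => N i +
    [ffun i => urn_selects alpha N (U 0%N w) i] i)%N =
    (fun i => N i + urn_selects alpha N (U 0%N w) i)%N by [].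
  by apply/funext => i; rewrite ffunE.
move=> [b _ [Cb]]; rewrite /mkset; suff -> : (fun i => N i + b i)%N =
  (fun i => N i + urn_selects alpha N (U 0%N w) i)%N by [].
by apply/funext => i; rewrite (Cb i I).
Qed.

Definition path_state c := foldr (fun i N => add_ball N i) N0 c.

Lemma path_state_gt0 c i : (0 < path_state c i)%N.
Proof. by elim: c i => [//|x c IH] i; exact: add_ball_gt0. Qed.

(* Paths are listed backwards: the head is the last selected colour. *)
Fixpoint path_prob c : R := if c is x :: c' then
  path_prob c' * (rate alpha (path_state c' x) / total_rate alpha (path_state c'))
  else 1.

Lemma path_prob_ge0 c : 0 <= path_prob c.
Proof.
elim: c => [//|x c IH] /=; rewrite mulr_ge0// divr_ge0 ?powR_ge0//.
by rewrite ltW// total_rate_gt0// => i; exact: path_state_gt0.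
Qed.

Section Events.
Variable U : nat -> {RV P >-> R}.
Hypothesis U_uniform : forall j, uniform01 (U j).
Hypothesis U_indep : mutually_independent U.

(** One condition per draw, so that independence applies; since paths are reversed, the head is
    governed by draw [size c']. *)
Fixpoint path_draws c (j : nat) : set R := if c is x :: c' then
  if j == size c' then [set u | urn_selects alpha (path_state c') u x]
  else path_draws c' j
  else setT.

Definition path_event c := \bigcap_(j in `I_(size c)) (U j @^-1` path_draws c j).

Lemma measurable_path_draws c j : measurable (path_draws c j).
Proof.
elim: c => [|x c IH] /=; first exact: measurableT.
by case: eqP => // _; exact: measurable_urn_selects.
Qed.

Lemma path_event_cons x c : path_event (x :: c) = path_event c `&`
  (U (size c) @^-1` [set u | urn_selects alpha (path_state c) u x]).
Proof.
apply/seteqP; split => w /=.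
  move=> h; split; last by have := h (size c); rewrite /= eqxx; apply.
  move=> j /= jc; have := h j; rewrite /= ltn_eqF//; apply.
  exact: ltnW.
move=> [h1 h2] j /=; rewrite ltnS leq_eqVlt => /predU1P[->|jc].
  by rewrite eqxx.
by rewrite ltn_eqF//; exact: h1.
Qed.

Lemma path_event_tally c w : path_event c w ->
  urn_tally alpha N0 (fun k => U k w) (size c) = path_state c.
Proof.
elim: c => [//|x c IH]; rewrite path_event_cons => -[/IH /= -> ux].
by apply: urn_selects_add => // i; exact: path_state_gt0.
Qed.

Lemma measurable_path_event c : measurable (path_event c).
Proof.
apply: fin_bigcap_measurable => // j _.
by apply: measurable_funPTI => //; exact: measurable_path_draws.
Qed.

Lemma independent_initial (B : nat -> set R) k : (forall j, measurable (B j)) ->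
  P (\bigcap_(j in `I_k) (U j @^-1` B j)) = (\prod_(j < k) P (U j @^-1` B j))%E.
Proof.
move=> mB; have := U_indep (J := [fset j in iota 0 k]%fset) (fun j _ => mB j).
have -> : [set` [fset j in iota 0 k]%fset] = `I_k.
  by apply/seteqP; split => j /=; rewrite !inE mem_iota.
move=> ->; rewrite -(big_mkord xpredT (fun j => P (U j @^-1` B j))).
apply: perm_big; rewrite /index_iota subn0.
apply: uniq_perm; rewrite ?fset_uniq ?iota_uniq//.
by move=> j; rewrite !inE.
Qed.

Lemma path_event_prob c : P (path_event c) = (path_prob c)%:E.
Proof.
rewrite independent_initial; last exact: measurable_path_draws.
elim: c => [|x c IH] /=; first by rewrite big_ord0.
rewrite big_ord_recr /= eqxx EFinM -IH; congr (_ * _)%E.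
  by apply: eq_bigr => j _; rewrite ltn_eqF.
by rewrite uniform01_urn_selects// => k; exact: path_state_gt0.
Qed.

Variable F : ('I_n.+1 -> nat) -> R.
Hypothesis F_le1 : forall N, (forall i, (0 < N i)%N) -> F N <= 1.
Hypothesis F_harmonic : forall N, (forall i, (0 < N i)%N) ->
  \sum_(i < n.+1) rate alpha (N i) * (F (add_ball N i) - F N) = 0.

Let value_event (e : R) j :=
  [set w | e < F (urn_tally alpha N0 (fun k => U k w) j)].

(** Markov's inequality for the martingale [F], without conditional expectations. At [l = 0],
    [F <= 1] and [0 <= e] make the indicator of [e < F] at least [F - e]; for larger [l] the event
    is split by the next colour and harmonicity averages the bounds. *)
Lemma path_event_value (e : R) l c : 0 <= e ->
  ((path_prob c * (F (path_state c) - e))%:E <=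
   P (path_event c `&` value_event e (size c + l)))%E.
Proof.
move=> e0; elim: l c => [|l IH] c.
  have [eF|Fe] := ltP e (F (path_state c)).
    have -> : path_event c `&` value_event e (size c + 0) = path_event c.
      apply/setIidl => w wc; rewrite /value_event /mkset addn0.
      by rewrite path_event_tally.
    rewrite path_event_prob lee_fin ler_piMr ?path_prob_ge0//.
    by have := F_le1 (path_state_gt0 c); lra.
  apply: (@le_trans _ _ 0%E); last exact: measure_ge0.
  by rewrite lee_fin mulr_ge0_le0 ?path_prob_ge0// subr_le0.
have s0 := path_state_gt0 c; have W0 := total_rate_gt0 alpha s0.
pose A (x : 'I_n.+1) :=
  path_event (x :: c) `&` value_event e (size (x :: c) + l).
have mA x : measurable (A x).
  apply: measurableI; first exact: measurable_path_event.
  exact: (measurable_urn_tally _ _ [set N | e < F N]).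
have tA : trivIset setT A.
  move=> x y _ _ [w [[+ _] [+ _]]]; rewrite !path_event_cons.
  by move=> [_ ux] [_ uy]; exact: urn_selects_inj ux uy.
have AS : \big[setU/set0]_(x < n.+1) A x `<=`
    path_event c `&` value_event e (size c + l.+1).
  move=> w; rewrite -bigcup_mkord_ord => -[x _ [+ wv]].
  by rewrite path_event_cons => -[wc _]; split=> //; rewrite addnS.
apply: (@le_trans _ _ (P (\big[setU/set0]_(x < n.+1) A x))); last first.
  apply: le_measure => //; rewrite inE.
    exact: bigsetU_measurable.
  apply: measurableI; first exact: measurable_path_event.
  exact: (measurable_urn_tally _ _ [set N | e < F N]).
rewrite measure_bigsetU_ord//.
apply: (@le_trans _ _ (\sum_(x < n.+1) (path_prob (x :: c) *
  (F (path_state (x :: c)) - e))%:E)%E); last by apply: lee_sum => x _; exact: IH.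
rewrite sumEFin lee_fin le_eqVlt; apply/orP; left; apply/eqP => /=.
set p := path_prob c; set W := total_rate _ _ in W0 *.
set N := path_state c in s0 W W0 *.
have -> : p * (F N - e) = p / W *
    (\sum_(x < n.+1) rate alpha (N x) * (F (add_ball N x) - F N) +
     \sum_(x < n.+1) rate alpha (N x) * (F N - e)).
  by rewrite (F_harmonic s0) add0r -mulr_suml -/W mulrA divfK// gt_eqF.
rewrite -big_split [LHS]big_distrr /=.
by apply: eq_bigr => x _; ring.
Qed.

Lemma urn_tally_value (e : R) j : 0 <= e ->
  ((F N0 - e)%:E <= P (value_event e j))%E.
Proof.
move=> e0; have := path_event_value j [::] e0; rewrite /= mul1r.
move=> /le_trans; apply; apply: le_measure; rewrite ?inE.
- apply: measurableI; first exact: measurable_path_event.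
  exact: (measurable_urn_tally _ _ [set N | e < F N]).
- exact: (measurable_urn_tally _ _ [set N | e < F N]).
- by apply: subIset; right.
Qed.

End Events.
End Paths.

(** * The event as an eventual property of the tallies *)

Section UrnEvent.
Variables (R : realType) (alpha : R) (m n : nat).
Hypothesis alpha_gt1 : 1 < alpha.
Hypothesis m_gt0 : (0 < m)%N.
Implicit Types (N : 'I_n.+1 -> nat) (u : nat -> R).

Local Notation init := (@initial_state m n).
Local Notation tally u := (urn_tally alpha init u).
Let avoidK := avoid alpha (2 * m).+1.
Let halfK := avoid_half alpha m (2 * m).+1.

(* As [1{Z <= 4} <= 16 * 2 ^- Z], this is at most the probability that, at the
   explosion time of colour 0, all other tallies are at most [2 * m] and at
   least 5 of them equal [m]. *)
Definition good_value N :=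
  urn_value alpha avoidK N - 16 * urn_value alpha halfK N.

(** [3 * m] is [m] balls and [2 * m] selections; [2 * m] is one ball and [2 * m - 1] selections. The
    first clause keeps colour 0 out of the five, as [m + (m - 1) < 3 * m]. *)
Definition good_state N := [&& (3 * m <= N ord0)%N,
  [forall i, (i != ord0) ==> (N i <= 2 * m)%N] &
  (5 <= #|[set i | N i == (init i + (m - 1))%N]%SET|)%N].

Lemma init_gt0 i : (0 < init i)%N.
Proof. by rewrite /initial_state; case: ifP. Qed.

Let b_avoid : backward alpha avoidK. Proof. exact: backward_avoid. Qed.
Let b_half : backward alpha halfK. Proof. exact: backward_avoid_half. Qed.

Let mK : (m < (2 * m).+1)%N. Proof. lia. Qed.

Lemma good_value_harmonic N : (forall i, (0 < N i)%N) ->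
  \sum_(i < n.+1) rate alpha (N i) * (good_value (add_ball N i) - good_value N)
  = 0.
Proof.
move=> N0.
have := urn_value_harmonic b_avoid N0.
have := urn_value_harmonic b_half N0.
set H := urn_value alpha halfK; set A := urn_value alpha avoidK => h1 h2.
transitivity (\sum_(i < n.+1) rate alpha (N i) * (A (add_ball N i) - A N) -
  16 * \sum_(i < n.+1) rate alpha (N i) * (H (add_ball N i) - H N)).
  rewrite big_distrr -sumrB /=; apply: eq_bigr => i _.
  rewrite /good_value -/A -/H.
  move: (rate _ _) (A (add_ball N i)) (A N) (H (add_ball N i)) (H N) => r x y z t.
  ring.
by rewrite h1 h2 mulr0 subrr.
Qed.

Lemma good_value_le1 N : (forall i, (0 < N i)%N) -> good_value N <= 1.
Proof.
move=> N0.
have hA : urn_value alpha avoidK N <= 1.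
  have -> : 1 = lap (explosion alpha (N ord0)) (es_one R).
    by rewrite lap_cons lap_nil explosion0// mulr1 addr0.
  apply: lap_explosion_le => //.
  - exact: (stable_es_prod b_avoid _ N0).
  - by rewrite /stable /= lexx.
  - move=> t t0; rewrite ev_one ev_es_prod.
    by apply: prodr_ile1 => i _; rewrite avoid_ge0// avoid_le1.
have hH : 0 <= urn_value alpha halfK N.
  apply: lap_explosion_ge0 => //; first exact: (stable_es_prod b_half _ N0).
  move=> t t0; rewrite ev_es_prod; apply: prodr_ge0 => i _.
  exact: avoid_half_ge0.
by rewrite /good_value; lra.
Qed.

Lemma good_value_eq0 N (i : 'I_n.+1) : (forall i, (0 < N i)%N) -> i != ord0 ->
  (2 * m < N i)%N -> good_value N = 0.
Proof.
move=> N0 i0 Ni.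
have io : i \in others n.
  apply/mapP; case: (unliftP ord0 i) i0 => [j -> _|->]; last by rewrite eqxx.
  by exists j => //; rewrite mem_enum.
have h (f : nat -> seq (R * R)) : backward alpha f ->
    (forall t, ev (f (N i)) t = 0) -> urn_value alpha f N = 0.
  move=> bu u0; rewrite -(lap_nil (explosion alpha (N ord0))).
  apply: lap_explosion_eq => //; first exact: (stable_es_prod bu _ N0).
  move=> t t0; rewrite ev_es_prod /ev lap_nil.
  by rewrite (big_rem i io) /= [X in X * _]u0 mul0r.
rewrite /good_value !h ?mulr0 ?subrr// => t.
  rewrite ev_avoid_half !ev_reach_ge//; [|lia|lia].
  by rewrite !subrr mul0r subr0.
by rewrite ev_avoid ev_reach_ge// subrr.
Qed.

Lemma tally_step u i j : tally u j.+1 i =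
  (tally u j i + urn_selects alpha (tally u j) (u j) i)%N.
Proof. by []. Qed.

Lemma tally_mono u i j k : (j <= k)%N -> (tally u j i <= tally u k i)%N.
Proof. exact: (tally_le (tally_step u i)). Qed.

Lemma tally_gt0 u j i : (0 < tally u j i)%N.
Proof. by apply: leq_trans (tally_mono u i (leq0n j)); exact: init_gt0. Qed.

Lemma others_stationary u :
  (forall i, i != ord0 -> forall j, (tally u j i <= 2 * m)%N) ->
  exists J, forall j, (J <= j)%N -> forall i, i != ord0 ->
    tally u j i = tally u J i.
Proof.
move=> h.
have h1 (i : 'I_n.+1) : exists J, i != ord0 ->
    forall j, (J <= j)%N -> tally u j i = tally u J i.
  have [->|i0] := eqVneq i ord0; first by exists 0%N.
  have [J HJ] := tally_stationary (tally_step u i) (h i i0).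
  by exists J.
have [f hf] := choice h1.
exists (\max_(i < n.+1) f i)%N => j jJ i i0.
have fi : (f i <= \max_(i < n.+1) f i)%N by exact: leq_bigmax.
by rewrite (hf i i0 _ fi) (hf i i0 j (leq_trans fi jJ)).
Qed.

(** Writes the event as a lower limit of finite-time events, whence its measurability. *)
Lemma good_eventP u :
  (only_0_selected_often alpha m n u /\ five_selected_exactly alpha m n u) <->
  exists J, forall j, (J <= j)%N -> good_state (tally u j).
Proof.
have m2 : (2 * m - 1).+1 = (2 * m)%N by lia.
have more i : selected_more_than alpha init u (2 * m - 1) i <->
    exists j, (init i + 2 * m <= tally u j i)%N.
  by rewrite /selected_more_than m2; exact: (card_le_stepsP (tally_step u i)).
have exact_ i : selected_exactly alpha init u (m - 1) i <->
    exists J, forall j, (J <= j)%N -> tally u j i = (init i + (m - 1))%N.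
  exact: (card_eq_stepsP (tally_step u i)).
have init0 : init ord0 = m by [].
have init1 i : i != ord0 -> init i = 1%N by rewrite /initial_state => /negbTE ->.
split=> [[only0 five]|[J HJ]].
  have /more[J0 HJ0] := (only0 ord0).2 erefl.
  have small i : i != ord0 -> forall j, (tally u j i <= 2 * m)%N.
    move=> i0 j; rewrite leqNgt; apply/negP => big.
    move/eqP : (i0); apply; apply/only0/more; exists j.
    by rewrite init1.
  have [J HJ] := others_stationary small.
  exists (maxn J0 J) => j; rewrite geq_max => /andP[jJ0 jJ].
  apply/and3P; split.
  - by have := tally_mono u ord0 jJ0; rewrite init0 in HJ0; lia.
  - by apply/forallP => i; apply/implyP => i0; exact: small.
  - move: five; rewrite /five_selected_exactly card_le_finset.
    move=> /leq_trans; apply; apply: subset_leq_card; apply/fintype.subsetP => i.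
    rewrite !inE => hi; have [J1 HJ1] := (exact_ i).1 hi.
    have [i0|i0] := eqVneq i ord0.
      have := HJ1 (maxn J0 J1) (leq_maxr _ _).
      have := tally_mono u ord0 (leq_maxl J0 J1).
      by rewrite i0 init0 in HJ0 *; lia.
    by rewrite HJ// -(HJ (maxn J J1)) ?leq_maxl// HJ1// leq_maxr.
have small i : i != ord0 -> forall j, (tally u j i <= 2 * m)%N.
  move=> i0 j; have /and3P[_ /forallP/(_ i)/implyP/(_ i0) + _] :=
    HJ _ (leq_maxl J j).
  by apply: leq_trans; apply: tally_mono; exact: leq_maxr.
split.
  move=> i; split=> [/more[j]|->].
    move=> h; apply/eqP; apply: contraTT isT => i0.
    by have := small i i0 j; rewrite init1// in h; lia.
  apply/more; exists J; have /and3P[+ _ _] := HJ J (leqnn _).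
  by rewrite init0; lia.
have [J1 HJ1] := others_stationary small.
have := HJ _ (leq_maxl J J1); set j := maxn J J1 => /and3P[h0 _ h5].
apply/card_le_finset; apply: leq_trans h5 _; apply: subset_leq_card.
apply/fintype.subsetP => i; rewrite !inE => /eqP hi.
apply/exact_; exists j => k jk.
have [i0|i0] := eqVneq i ord0.
  by move: hi h0; rewrite i0 init0; lia.
have jJ1 : (J1 <= j)%N by exact: leq_maxr.
by rewrite HJ1 ?(leq_trans jJ1)// -(HJ1 j).
Qed.

End UrnEvent.

(** * From the harmonic function to the probability of the event *)

Section LimitingEvent.
Variables (R : realType) (alpha : R) (m n : nat).
Hypothesis alpha_gt1 : 1 < alpha.
Hypothesis m_gt0 : (0 < m)%N.
Implicit Types (N : 'I_n.+1 -> nat) (u : nat -> R).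

Local Notation init := (@initial_state m n).
Local Notation tally u := (urn_tally alpha init u).
Let avoidK := avoid alpha (2 * m).+1.
Let halfK := avoid_half alpha m (2 * m).+1.

Let es_prod_others (f : nat -> seq (R * R)) N N' :
  (forall i, i != ord0 -> N i = N' i) ->
  es_prod f (others n) N = es_prod f (others n) N'.
Proof.
move=> h; rewrite /others; elim: (enum _) => //= i r ->.
by rewrite h.
Qed.

(** At time 0 the first product is at most 1 and the second is [2 ^- Z], with [Z] the number of
    other tallies equal to [m]; since [16 = 2 ^ 4], positivity forces [Z >= 5]. *)
Let five_of_value N : (forall i, (0 < N i)%N) ->
  (forall i, i != ord0 -> (N i <= 2 * m)%N) ->
  0 < ev (es_prod avoidK (others n) N) 0 -
    16 * ev (es_prod halfK (others n) N) 0 ->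
  (5 <= #|[set i | N i == (init i + (m - 1))%N]%SET|)%N.
Proof.
move=> N0 small.
have mK : (m < (2 * m).+1)%N by lia.
have hA : ev (es_prod avoidK (others n) N) 0 <= 1.
  rewrite ev_es_prod; apply: prodr_ile1 => i _.
  by rewrite avoid_ge0// avoid_le1.
pose Z := [set i : 'I_n | N (lift ord0 i) == m]%SET.
have hB : ev (es_prod halfK (others n) N) 0 = 2^-1 ^+ #|Z|.
  rewrite ev_es_prod big_others -prodr_const big_mkcond [RHS]big_mkcond /=.
  apply: eq_bigr => i _; rewrite inE ev_avoid_half0//.
  by rewrite leqNgt ltnS small.
have ZS : (#|Z| <= #|[set i | N i == (init i + (m - 1))%N]%SET|)%N.
  rewrite -(card_imset _ (@lift_inj n.+1 ord0)).
  apply: subset_leq_card; apply/fintype.subsetP => _ /imsetP[i + ->].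
  by rewrite !inE /initial_state /= => /eqP ->; lia.
move=> pos; apply: leq_trans ZS; rewrite ltnNge; apply/negP => Z4.
have : (2^-1 : R) ^+ 4 <= 2^-1 ^+ #|Z|.
  by apply: ler_wiXn2l => //; lra.
by move: pos; rewrite hB => ? ?; lra.
Qed.

(** A tally passing [2 * m] would make the value 0 from then on. So the other tallies freeze, colour
    0 takes every later step, and the value converges to its form at time 0, which is at least
    [e]. *)
Lemma good_value_io u (e : R) : (forall j, 0 < u j <= 1) -> 0 < e ->
  (forall J, exists2 j, (J <= j)%N & e < good_value alpha m (tally u j)) ->
  exists J, forall j, (J <= j)%N -> good_state m (tally u j).
Proof.
move=> u01 e0 io.
have T0 j i : (0 < tally u j i)%N by exact: tally_gt0.
have small i : i != ord0 -> forall j, (tally u j i <= 2 * m)%N.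
  move=> i0 j; rewrite leqNgt; apply/negP => big.
  have [k jk] := io j; rewrite (good_value_eq0 alpha_gt1 m_gt0 (T0 k) i0).
    by rewrite ltNge (ltW e0).
  by apply: leq_trans big _; exact: tally_mono.
have [J HJ] := others_stationary small.
have grow k : tally u (J + k) ord0 = (tally u J ord0 + k)%N.
  elim: k => [|k IH]; first by rewrite !addn0.
  have [x ux] := urn_selects_ex alpha (T0 (J + k)%N) (u01 (J + k)%N).
  have [x0|x0] := eqVneq x ord0.
    by rewrite addnS tally_step -x0 ux x0 IH addn1 addnS.
  have := HJ (J + k.+1)%N (leq_addr _ _) x x0.
  by rewrite addnS tally_step ux HJ ?leq_addr//; lia.
pose sA := es_prod avoidK (others n) (tally u J).
pose sB := es_prod halfK (others n) (tally u J).
have stA : stable sA.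
  by apply: stable_es_prod; first exact: backward_avoid.
have stB : stable sB.
  by apply: stable_es_prod; first exact: backward_avoid_half.
have cv : (fun k => good_value alpha m (tally u (J + k))) @ \oo -->
    ev sA 0 - 16 * ev sB 0.
  have -> : (fun k => good_value alpha m (tally u (J + k))) =
      (fun k => lap (explosion alpha (k + tally u J ord0)) sA -
         16 * lap (explosion alpha (k + tally u J ord0)) sB).
    apply/funext => k; rewrite /good_value /urn_value grow addnC.
    have eo i : i != ord0 -> tally u (J + k) i = tally u J i.
      by move=> i0; apply: HJ i0; exact: leq_addr.
    by rewrite !(es_prod_others _ eo).
  apply: cvgB.
    rewrite (cvg_shiftn _ (fun k => lap (explosion alpha k) sA)).
    exact: lap_explosion_cvg.
  apply: cvgMr; rewrite (cvg_shiftn _ (fun k => lap (explosion alpha k) sB)).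
  exact: lap_explosion_cvg.
have pos : 0 < ev sA 0 - 16 * ev sB 0.
  apply: lt_le_trans e0 _; rewrite leNgt; apply/negP => /(cvgr_lt _ cv)[M _ HM].
  have [j Mj] := io (J + M)%N.
  have jE : j = (J + (j - J))%N by lia.
  rewrite jE ltNge => /negP; apply; apply/ltW/HM => /=; lia.
exists (J + 3 * m)%N => j Jj.
have jE : j = (J + (j - J))%N by lia.
have sm j' i : i != ord0 -> (tally u j' i <= 2 * m)%N.
  by move=> i0; exact: small.
apply/and3P; split.
- by rewrite jE grow; lia.
- by apply/forallP => i; apply/implyP => i0; exact: small.
- apply: five_of_value => //; first exact: sm.
  have eo i : i != ord0 -> tally u j i = tally u J i.
    by move=> i0; apply: HJ i0; lia.
  by rewrite !(es_prod_others _ eo).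
Qed.

Lemma good_event_prob (d : measure_display) (T : measurableType d)
    (P : probability T R) (U : nat -> {RV P >-> R}) :
  (forall j, uniform01 (U j)) -> mutually_independent U ->
  let E := [set w : T | only_0_selected_often alpha m n (fun j => U j w) /\
      five_selected_exactly alpha m n (fun j => U j w)] in
  measurable E /\ ((good_value alpha m init)%:E <= P E)%E.
Proof.
move=> Uu Ui E.
have EE : E = \bigcup_J \bigcap_(j in [set j | (J <= j)%N])
    [set w | good_state m (tally (fun k => U k w) j)].
  apply/seteqP; split => w.
    by move=> /(@good_eventP R alpha m n alpha_gt1 m_gt0 _)[J HJ]; exists J.
  by move=> [J _ HJ]; apply/(@good_eventP R alpha m n alpha_gt1 m_gt0 _); exists J.
have mE : measurable E.
  rewrite EE; apply: bigcup_measurable => J _.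
  apply: bigcap_measurable; first by exists J => /=.
  by move=> j _; exact: (measurable_urn_tally _ _ _ [set N | good_state m N]).
split=> //.
pose in01 j := U j @^-1` [set` `]0, 1]].
have min01 j : measurable (in01 j) by apply: measurable_funPTI.
have Pin01 j : P (in01 j) = 1%E.
  by rewrite /in01 uniform01_itv// subr0.
pose B := \bigcup_j ~` in01 j.
have mB : measurable B.
  by apply: bigcup_measurable => j _; exact: measurableC.
have PB : P B = 0%E.
  apply/negligibleP => //; apply: negligible_bigcup => j.
  apply/negligibleP; first exact: measurableC.
  by apply: etrans (probability_setC P (min01 j)) _; rewrite Pin01 subee.
have B01 w : ~ B w -> forall j, 0 < U j w <= 1.
  move=> nB j; have [/= hin|nin] := pselect (in01 j w).
    by move: hin; rewrite /in01 /= in_itv.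
  by case: nB; exists j.
apply/lee_addgt0Pr => e e0.
pose V j := [set w | e < good_value alpha m (tally (fun k => U k w) j)].
have mV j : measurable (V j).
  exact: (measurable_urn_tally _ _ _ [set N | e < good_value alpha m N]).
have PV j : ((good_value alpha m init - e)%:E <= P (V j))%E.
  apply: urn_tally_value => //.
  - exact: init_gt0.
  - exact: good_value_le1.
  - exact: good_value_harmonic.
  - exact: ltW.
(* Reverse Fatou: the [V j] have a common lower bound in probability, which passes to their upper
   limit by continuity from above. *)
pose W J := \bigcup_(j in [set j | (J <= j)%N]) V j.
have mW J : measurable (W J) by apply: bigcup_measurable.
have mWI : measurable (\bigcap_J W J) by apply: bigcapT_measurable.
have niW : nonincreasing_seq W.
  move=> j k jk; apply/subsetPset => w [l /= kl Vl]; exists l => //=.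
  exact: leq_trans jk kl.
have PW0 : (P (W 0%N) < +oo)%E.
  by rewrite (le_lt_trans (probability_le1 _ _))// ltry.
have cW := nonincreasing_cvg_mu PW0 mW mWI niW.
have PWI : ((good_value alpha m init - e)%:E <= P (\bigcap_J W J))%E.
  rewrite -(cvg_lim _ cW)//; apply: lime_ge; first exact: cvgP cW.
  apply: nearW => J /=; apply: le_trans (PV J) _.
  by apply: le_measure; rewrite ?inE// => w Vw; exists J => /=.
have WE : \bigcap_J W J `<=` E `|` B.
  move=> w Ww; have [Bw|nBw] := pselect (B w); first by right.
  left; apply/(@good_eventP R alpha m n alpha_gt1 m_gt0 _).
  apply: (good_value_io (B01 w nBw) e0) => J.
  by have [j Jj Vj] := Ww J I; exists j.
rewrite -leeBlDr// -EFinB; apply: le_trans PWI _.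
apply: (@le_trans _ _ (P (E `|` B))).
  by apply: le_measure; rewrite ?inE//; exact: measurableU.
by rewrite -[leRHS]adde0 -PB; exact: measureU2.
Qed.

End LimitingEvent.

(** * Concentration of the explosion time and the exponential gap *)

Section Estimates.
Variables (R : realType) (alpha : R).
Hypothesis alpha_gt1 : 1 < alpha.
Local Notation rate := (rate alpha).
Local Notation explosion := (explosion alpha).
Local Notation C := (tail_const alpha).

(* Chebyshev's inequality for [exp (- mu T)], [T] the explosion time; the
   interval for [T] is centred at [- ln b / mu]. *)
Lemma lap_explosion_window m (mu delta c c' : R) s (b := explosion m mu)
    (eta := 1 - expR (delta * ln b)) : (0 < m)%N -> 0 < mu -> 0 < delta ->
  0 < b < 1 -> 0 <= c' -> 0 <= c -> stable s ->
  (forall t, 0 <= t -> - c' <= ev s t) ->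
  (forall t, - ln b / mu * (1 - delta) <= t <= - ln b / mu * (1 + delta) ->
     c <= ev s t) ->
  c - (c + c') * ((explosion m (2 * mu) - b ^+ 2) / (b * eta) ^+ 2) <=
    lap (explosion m) s.
Proof.
move=> m0 mu0 d0 /andP[b0 b1] c'0 c0 st low mid.
have l0 : ln b < 0 by rewrite ln_lt0// b0.
have e0 : 0 < eta by rewrite subr_gt0 expR_lt1 pmulr_rlt0.
set D := (c + c') / (b * eta) ^+ 2.
have D0 : 0 <= D by rewrite divr_ge0 ?addr_ge0// sqr_ge0.
(* The minorant [c - D * (exp (- mu * t) - b) ^ 2], expanded; [D] makes it at most [- c'] outside
   the window. *)
pose s' := es_scale c (es_one R) ++
  es_scale (- D) [:: (1, 2 * mu); (- 2 * b, mu); (b ^+ 2, 0)].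
have -> : c - (c + c') * ((explosion m (2 * mu) - b ^+ 2) / (b * eta) ^+ 2) =
    lap (explosion m) s'.
  rewrite lap_cat !lap_scale !lap_cons !lap_nil /= explosion0// -/b /D.
  ring.
apply: lap_explosion_le => //.
  rewrite stable_cat !stable_scale /stable /= lexx.
  by rewrite (ltW mu0) mulr_ge0// ltW.
move=> t t0; set x := expR (- mu * t).
have -> : ev s' t = c - D * (x - b) ^+ 2.
  rewrite ev_cat !ev_scale ev_one /ev !lap_cons lap_nil /= oppr0 mul0r expR0.
  have -> : expR (- (2 * mu) * t) = x ^+ 2.
    by rewrite expr2 -expRD; congr expR; ring.
  by rewrite -/x; ring.
have [win|out] := boolP
    (- ln b / mu * (1 - delta) <= t <= - ln b / mu * (1 + delta)).
  by apply: le_trans (mid t win); rewrite gerBl mulr_ge0// sqr_ge0.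
apply: le_trans (low t t0); rewrite lerBlDr.
suff h : (b * eta) ^+ 2 <= (x - b) ^+ 2.
  have be : 0 < (b * eta) ^+ 2 by rewrite exprn_gt0// mulr_gt0.
  have : c + c' <= D * (x - b) ^+ 2.
    by rewrite /D mulrAC ler_pdivlMr// ler_wpM2l// addr_ge0.
  by lra.
have bE : b = expR (ln b) by rewrite lnK.
(* [eta] is exact for late times; for early ones [1 - exp y <= exp (- y) - 1] makes the deviation at
   least as large. *)
have key : b * eta <= `|x - b|.
  move: out; rewrite negb_and -!ltNge => /orP[tl|tl].
    have h1 : b * expR (- (delta * ln b)) <= x.
      rewrite {1}bE -expRD ler_expR.
      have := ltW tl; rewrite -(ler_pM2l mu0).
      have -> : mu * (- ln b / mu * (1 - delta)) = - ln b * (1 - delta).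
        by field; rewrite gt_eqF.
      by lra.
    have h2 : 1 - expR (delta * ln b) <= expR (- (delta * ln b)) - 1.
      have := expR_ge1Dx (delta * ln b); have := expR_ge1Dx (- (delta * ln b)).
      by lra.
    have h3 := ler_wpM2l (ltW b0) h2.
    by apply: le_trans (ler_norm _); rewrite /eta; lra.
  have h1 : x <= b * expR (delta * ln b).
    rewrite {1}bE -expRD ler_expR.
    have := ltW tl; rewrite -(ler_pM2l mu0).
    have -> : mu * (- ln b / mu * (1 + delta)) = - ln b * (1 + delta).
      by field; rewrite gt_eqF.
    by lra.
  by rewrite distrC; apply: le_trans (ler_norm _); rewrite /eta; lra.
by rewrite -(real_normK (num_real (x - b))) ler_pXn2r// nnegrE mulr_ge0// ltW.
Qed.

(** Since tallies start at 1, [k] jumps lead to [k + 1]: [q (2 * m)] is the probability of exceeding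
    [2 * m], and [q m.-1 - q m] that of being equal to [m]. *)
Definition passage k (t : R) := ev (birth alpha k 1) t.
Local Notation q := passage.

Let rate_gt0' k : (0 < k)%N -> 0 < rate k. Proof. exact: rate_gt0. Qed.

Lemma passage0 t : q 0 t = 1. Proof. exact: ev_one. Qed.

Lemma passage_S0 k : q k.+1 0 = 0. Proof. exact: birth_S0. Qed.

Lemma is_derive_passage k (x : R) :
  is_derive x 1 (q k.+1) (rate k.+1 * (q k x - q k.+1 x)).
Proof.
have := ev_is_derive (birth alpha k.+1 1) x.
by rewrite birth_forward// add1n.
Qed.

Lemma passage_props k t : 0 <= t -> [/\ 0 <= q k t, q k t <= 1 & q k.+1 t <= q k t].
Proof.
move=> t0; split.
- exact: (birth_ge0 rate_gt0' passage0 passage_S0 is_derive_passage).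
- exact: (birth_le1 rate_gt0' passage0 passage_S0 is_derive_passage).
- exact: (birth_leS rate_gt0' passage0 passage_S0 is_derive_passage).
Qed.

Lemma passage_anti k l t : 0 <= t -> (k <= l)%N -> q l t <= q k t.
Proof.
move=> t0 /subnKC <-; elim: (l - k)%N => [|d IH]; first by rewrite addn0.
by apply: le_trans IH; rewrite addnS; have [] := passage_props (k + d) t0.
Qed.

(** [birth_ratio] from level [k0], about [x * m], yields a logarithmic derivative of at least
    [theta * m ^ alpha] at all later levels. As rates up to [2 * m] are at most
    [2 ^ alpha * m ^ alpha], each level from [m] to [2 * m] costs the factor
    [1 + theta / 2 ^ alpha]. *)
Lemma birth_exact_ratio (tau : R) : 0 < tau ->
  exists theta : R, exists m1 : R, 0 < theta /\ forall m (t : R),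
    m1 <= m%:R -> 0 < t <= tau * m%:R `^ (1 - alpha) ->
    theta * (1 + theta / 2 `^ alpha) ^+ m * q (2 * m) t <=
    q m.-1 t - q m t.
Proof.
move=> tau0.
have [x [x0 xle xtau]] : exists x : R,
    [/\ 0 < x, x <= 2^-1 & x `^ alpha * tau <= x / 4].
  (* [y] solves [tau * y ^ (alpha - 1) = 1 / 4]; the cap 1/2 keeps [k0] below [m]. *)
  pose y := (4 * tau)^-1 `^ (alpha - 1)^-1.
  have y0 : 0 < y by rewrite powR_gt0// invr_gt0 mulr_gt0.
  exists (Num.min y 2^-1); split.
  - by rewrite lt_min y0 invr_gt0 ltr0n.
  - by rewrite ge_min lexx orbT.
  - set z := Num.min _ _.
    have z0 : 0 < z by rewrite lt_min y0 invr_gt0 ltr0n.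
    have zy : z <= y by rewrite ge_min lexx.
    have -> : z `^ alpha = z * z `^ (alpha - 1).
      by rewrite mulr_powRB1 ?ltW// (lt_trans _ alpha_gt1).
    have : z `^ (alpha - 1) <= (4 * tau)^-1.
      have -> : (4 * tau)^-1 = y `^ (alpha - 1).
        rewrite -powRrM mulVf ?gt_eqF ?subr_gt0// powRr1//.
        by rewrite invr_ge0 mulr_ge0// ltW.
      by rewrite ge0_ler_powR ?nnegrE ?subr_ge0 ?(ltW z0) ?(ltW y0)// ltW.
    move=> h; rewrite -mulrA ler_pM2l//.
    apply: le_trans (ler_wpM2r (ltW tau0) h) _.
    by rewrite invfM -mulrA mulVf ?gt_eqF// mulr1.
(* Now [(theta + x ^ alpha) * tau * m <= x * m / 2], and [2 <= x * m] ensures that truncating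
   [x * m] loses at most half of it. *)
pose theta := x / (4 * tau); exists theta; exists (2 / x).
have th0 : 0 < theta by rewrite divr_gt0// mulr_gt0.
split=> // m t m1 /andP[t0 tm].
have xm : 2 <= x * m%:R by rewrite mulrC -ler_pdivrMr.
have m4 : 4 <= m%:R :> R.
  have : x * m%:R <= 2^-1 * m%:R by rewrite ler_wpM2r.
  by lra.
have mgt0 : (0 < m)%N by rewrite -(ltr0n R); lra.
have mR0 : (0 : R) < m%:R by rewrite ltr0n.
pose k0 := Num.truncn (x * m%:R).
have /andP[k0l k0u] : k0%:R <= x * m%:R < k0.+1%:R.
  by apply: truncn_itv; rewrite mulr_ge0// ltW.
have k0m : (k0 <= m.-1)%N.
  rewrite -ltnS prednK// -(ltr_nat R).
  have : x * m%:R <= 2^-1 * m%:R by rewrite ler_wpM2r.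
  by lra.
have am : 0 < m%:R `^ alpha :> R by rewrite powR_gt0.
pose lam := theta * m%:R `^ alpha.
pose c := (x * m%:R) `^ alpha.
have cE : c = x `^ alpha * m%:R `^ alpha by rewrite /c powRM// ltW.
have ratio k : (m.-1 <= k)%N ->
    lam * q k.+1 t <= rate k.+1 * (q k t - q k.+1 t).
  move=> mk; apply: (@birth_ratio _ _ _ rate_gt0' passage0 passage_S0
    is_derive_passage c k0) => //.
  - exact: leq_trans k0m mk.
  - exact: powR_ge0.
  - by rewrite mulr_ge0// ltW.
  - move=> j /andP[j0 jk]; rewrite ge0_ler_powR ?nnegrE ?mulr_ge0 ?(ltW x0)//.
      by rewrite (le_trans ler01)// ltW.
    by apply: le_trans k0l; rewrite ler_nat.
  - have -> : lam + c = (theta + x `^ alpha) * m%:R `^ alpha.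
      by rewrite cE mulrDl.
    have s0 : 0 <= (theta + x `^ alpha) * m%:R `^ alpha.
      by rewrite mulr_ge0 ?addr_ge0 ?powR_ge0// ltW.
    apply: le_trans (ler_wpM2l s0 tm) _.
    have -> : (theta + x `^ alpha) * m%:R `^ alpha *
        (tau * m%:R `^ (1 - alpha)) = (theta * tau + x `^ alpha * tau) *
        (m%:R `^ alpha * m%:R `^ (1 - alpha)) by ring.
    rewrite -powRD; last by rewrite (gt_eqF mR0) implybT.
    rewrite subrKC powRr1//.
    have -> : theta * tau = x / 4 by rewrite /theta; field; rewrite gt_eqF.
    have h : (x / 4 + x `^ alpha * tau) * m%:R <= (x / 4 + x / 4) * m%:R.
      by rewrite ler_wpM2r// lerD2l.
    apply: le_trans h _; move: k0u; rewrite -natr1; lra.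
have tge0 := ltW t0.
set r := 1 + theta / 2 `^ alpha.
have r0 : 0 <= r by rewrite addr_ge0// divr_ge0 ?powR_ge0// ltW.
have step k : (m <= k < 2 * m)%N -> r * q k.+1 t <= q k t.
  move=> /andP[mk k2m].
  have := ratio k (leq_trans (leq_pred _) mk).
  have rk : rate k.+1 <= 2 `^ alpha * m%:R `^ alpha.
    by rewrite -powRM// -natrM; exact: rate_le.
  have dq0 : 0 <= q k t - q k.+1 t.
    by rewrite subr_ge0; apply: passage_anti.
  move=> /le_trans/(_ (ler_wpM2r dq0 rk)) h.
  have : m%:R `^ alpha * (theta * q k.+1 t) <=
      m%:R `^ alpha * (2 `^ alpha * (q k t - q k.+1 t)).
    by move: h; rewrite /lam; lra.
  rewrite ler_pM2l// mulrC (mulrC (2 `^ alpha)) -ler_pdivrMr ?powR_gt0//.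
  by rewrite /r; lra.
have chain l : (l <= m)%N -> r ^+ l * q (m + l)%N t <= q m t.
  elim: l => [|l IH] lm; first by rewrite expr0 mul1r addn0.
  apply: le_trans (IH (ltnW lm)); rewrite exprSr -mulrA ler_wpM2l ?exprn_ge0//.
  by rewrite addnS step// leq_addr mul2n -addnn ltn_add2l.
have := chain m (leqnn m); rewrite addnn -mul2n => hm.
have := ratio m.-1 (leqnn _); rewrite prednK// /lam -/(rate m).
move=> h; have : rate m * (theta * q m t) <= rate m * (q m.-1 t - q m t).
  by move: h; lra.
rewrite ler_pM2l// => h1; apply: le_trans h1.
by rewrite -mulrA ler_wpM2l// ltW.
Qed.

End Estimates.

(** * The number of colours and the integrand on the time window *)

Section Conclusion.
Variables (R : realType) (alpha : R).
Hypothesis alpha_gt1 : 1 < alpha.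
Local Notation rate := (rate alpha).
Local Notation explosion := (explosion alpha).
Local Notation C := (tail_const alpha).
Local Notation q := (passage alpha).

Let rate_gt0' k : (0 < k)%N -> 0 < rate k. Proof. exact: rate_gt0. Qed.

Lemma expR_sub1_le (y : R) : 0 <= y <= 2^-1 -> expR y - 1 <= 2 * y.
Proof.
move=> /andP[y0 y1]; have h := expR_ge1Dx (- y); have e0 := expR_gt0 y.
have : expR y * (1 - y) <= expR y * expR (- y) by rewrite ler_wpM2l// ltW.
rewrite expRxMexpNx_1 => h1.
have h2 : expR y * 2^-1 <= expR y * (1 - y) by rewrite ler_wpM2l ?(ltW e0)//; lra.
have h3 : expR y * y <= 2 * y by rewrite ler_wpM2r//; lra.
by lra.
Qed.

Lemma good_value_init_ge m n (c : R) : (0 < m)%N ->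
  (forall s, stable s -> (forall t, 0 <= t -> ev s t =
    (1 - q (2 * m) t) ^+ n -
    16 * (1 - q (2 * m) t - (q m.-1 t - q m t) / 2) ^+ n) ->
    c <= lap (explosion m) s) ->
  c <= good_value alpha m (@initial_state m n).
Proof.
move=> m0 h.
have N0 i : (0 < @initial_state m n i)%N by exact: init_gt0.
pose sA := es_prod (avoid alpha (2 * m).+1) (others n) (@initial_state m n).
pose sB := es_prod (avoid_half alpha m (2 * m).+1) (others n) (@initial_state m n).
have -> : good_value alpha m (@initial_state m n) =
    lap (explosion m) (sA ++ es_scale (- 16) sB).
  by rewrite lap_cat lap_scale mulNr.
apply: h.
  rewrite stable_cat stable_scale /sA /sB.
  rewrite (stable_es_prod (backward_avoid alpha_gt1 _)) ?N0//.
  by rewrite (stable_es_prod (backward_avoid_half alpha_gt1 _ _)).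
move=> t t0; rewrite ev_cat ev_scale mulNr !ev_es_prod !big_others.
have eA (i : 'I_n) : initial_state m (lift ord0 i) = 1%N by [].
under eq_bigr do rewrite eA; under [in X in _ - X]eq_bigr do rewrite eA.
rewrite !prodr_const card_ord ev_avoid_half ev_avoid /reach !subSS !subn0.
by rewrite subn1.
Qed.

(** [x] and [y] are the probabilities of passing [2 * m] and of being at [m]. The first power is at
    least [1 - n * x >= 95 / 100]; the second is at most [1 / (1 + y / 2) ^ n <= 2 / z], which costs
    at most [2 / 100]. *)
Lemma good_integrand_ge (x y z : R) n : 0 <= x <= 1 -> 0 <= 1 - x - y / 2 ->
  n%:R * x <= 20^-1 -> 0 < z -> z <= n%:R * y -> 32 / z <= 50^-1 -> 0 <= y ->
  93 / 100 <= (1 - x) ^+ n - 16 * (1 - x - y / 2) ^+ n.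
Proof.
move=> /andP[x0 x1] h nx z0 zn hz y0.
have b1 : 1 + n%:R * (- x) <= (1 + (- x)) ^+ n by apply: bernoulli; lra.
have y2 : 0 <= 1 + y / 2 by lra.
have b2 : 1 + n%:R * (y / 2) <= (1 + y / 2) ^+ n by apply: bernoulli; lra.
have h1 : (1 - x - y / 2) ^+ n * (1 + y / 2) ^+ n <= 1.
  rewrite -exprMn exprn_ile1 ?mulr_ge0//.
  have : (1 - x - y / 2) * (1 + y / 2) <= (1 - y / 2) * (1 + y / 2).
    by rewrite ler_wpM2r//; lra.
  have -> : (1 - y / 2) * (1 + y / 2) = 1 - (y / 2) ^+ 2 by ring.
  by have := sqr_ge0 (y / 2); lra.
have w0 : 0 <= (1 - x - y / 2) ^+ n by rewrite exprn_ge0.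
move: w0 h1 b1; set w := (1 - x - y / 2) ^+ n => w0 h1 b1.
have h2 : w * (z / 2) <= 1.
  by apply: le_trans h1; rewrite ler_wpM2l//; lra.
have h3 : 16 * w <= 32 / z by rewrite ler_pdivlMr//; lra.
by lra.
Qed.

(** At the inverse time scale [mu], [b] stays away from 0 and 1 uniformly in [m], while the relative
    variance is of order [1 / m]. *)
Lemma explosion_scaled m (mu := m%:R `^ alpha / m%:R : R) (b := explosion m mu) :
  (0 < m)%N -> [/\ 0 < mu, m%:R `^ (1 - alpha) = mu^-1, 0 < b < 1,
    ln (1 + (2 `^ alpha)^-1) <= - ln b <= C &
    explosion m (2 * mu) <= b ^+ 2 * expR (C / m%:R)].
Proof.
move=> m0.
have mR0 : 0 < m%:R :> R by rewrite ltr0n.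
have ma : 0 < m%:R `^ alpha :> R by rewrite powR_gt0.
have mu0 : 0 < mu by rewrite divr_gt0.
have mum : m%:R `^ (1 - alpha) = mu^-1 :> R.
  apply: (mulfI (lt0r_neq0 mu0)); rewrite mulfV ?gt_eqF//.
  rewrite /mu mulrAC -powRD; last by rewrite (gt_eqF mR0) implybT.
  by rewrite subrKC powRr1// divff// gt_eqF.
have p2 : 0 < 2 `^ alpha :> R by rewrite powR_gt0.
have bl : expR (- C) <= b.
  have := explosion_ge_expR alpha_gt1 m0 (ltW mu0).
  by rewrite mum mulrCA mulfV ?gt_eqF// mulr1.
have b0 : 0 < b by apply: lt_le_trans bl; exact: expR_gt0.
have bu : b <= (1 + (2 `^ alpha)^-1)^-1.
  have := explosion_le alpha_gt1 m0 (ltW mu0).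
  have -> : rate (m + m) = 2 `^ alpha * m%:R `^ alpha.
    by rewrite -powRM// -natrM mul2n addnn.
  rewrite /mu; congr (_ <= (1 + _)^-1).
  by field; rewrite !gt_eqF.
have d0 : 0 < 1 + (2 `^ alpha)^-1 :> R by rewrite addr_gt0 ?invr_gt0.
split=> //.
- rewrite b0; apply: le_lt_trans bu _.
  by rewrite invf_lt1// ltrDl invr_gt0.
- apply/andP; split; last by rewrite lerNl -ler_expR lnK.
  rewrite lerNr -lnV ?posrE//.
  by rewrite ler_ln ?posrE ?invr_gt0.
- have := explosion_double alpha_gt1 m0 (ltW mu0).
  rewrite mum; congr (_ <= _ * expR _).
  by rewrite /rate /mu; field; rewrite !gt_eqF.
Qed.

(** The window may cost [((1 - delta) / (1 + delta)) ^ (2 * m)]; this [delta] gives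
    [r * (1 - 4 * delta) = (1 + r) / 2], so a gain above 1 per level survives. *)
Lemma ratio_margin (r : R) : 1 < r -> exists delta : R,
  [/\ 0 < delta, delta <= 8^-1 &
   (1 + r) / 2 <= r * ((1 - delta) / (1 + delta)) ^+ 2].
Proof.
move=> r1; pose delta := (r - 1) / (8 * r); exists delta.
have d0 : 0 < delta by rewrite divr_gt0 ?mulr_gt0//; lra.
have d1 : delta <= 8^-1 by rewrite ler_pdivrMr ?mulr_gt0//; lra.
split=> //; set g := (1 - delta) / _.
have gl : 1 - 2 * delta <= g by rewrite ler_pdivlMr; [nra|lra].
have g2 : (1 - 2 * delta) ^+ 2 <= g ^+ 2 by rewrite ler_pXn2r// nnegrE; lra.
have dE : delta * (8 * r) = r - 1 by rewrite divfK// gt_eqF// mulr_gt0//; lra.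
have : r * (1 - 4 * delta) <= r * g ^+ 2.
  rewrite ler_pM2l; last by lra.
  by apply: le_trans g2; have := sqr_ge0 delta; rewrite !expr2; lra.
by lra.
Qed.

(* If the number [n] of initially small colours is [1 / (20 qp)], with [qp] the
   probability that a single one exceeds [2 * m] in the time window, then few
   colours exceed [2 * m], but about [n * rho ^ m * qp] of them are at [m]. *)
Lemma window_choice m (theta r t1 t2 : R) (g := t1 / t2) :
  0 < theta -> 1 < r -> 0 < t1 -> t1 <= t2 -> (1 + r) / 2 <= r * g ^+ 2 ->
  64 * 10 ^+ 3 <= theta * (m%:R * ((r - 1) / 2)) ->
  (forall t, 0 < t <= t2 -> theta * r ^+ m * q (2 * m) t <= q m.-1 t - q m t) ->
  exists n, (5 <= n)%N /\ forall t, t1 <= t <= t2 -> 93 / 100 <=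
    (1 - q (2 * m) t) ^+ n -
    16 * (1 - q (2 * m) t - (q m.-1 t - q m t) / 2) ^+ n.
Proof.
move=> th0 r1 t10 t12 rg big ratio.
have t20 : 0 < t2 by apply: lt_le_trans t12.
have g0 : 0 < g by rewrite divr_gt0.
pose rho := (1 + r) / 2; pose qp := q (2 * m) t2.
have qp0 : 0 < qp.
  exact: (birth_gt0 rate_gt0' (passage0 _) (passage_S0 _)
    (is_derive_passage alpha_gt1)).
(* [q (2 * m)] grows at most like [t ^ (2 * m)], by [birth_power_le]. *)
have mono t : t1 <= t <= t2 -> g ^+ 2 ^+ m * qp <= q (2 * m) t <= qp.
  move=> /andP[h1 h2]; have t0 : 0 < t by apply: lt_le_trans h1.
  have nd := @birth_nondecreasing _ _ _ rate_gt0' (passage0 _) (passage_S0 _)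
    (is_derive_passage alpha_gt1) (2 * m)%N.
  apply/andP; split; last exact: nd (ltW t0) h2.
  apply: le_trans (nd _ _ (ltW t10) h1).
  have := @birth_power_le _ _ _ rate_gt0' (passage0 _) (passage_S0 _)
    (is_derive_passage alpha_gt1) (2 * m)%N _ _ t10 t12.
  have -> : g ^+ 2 ^+ m = t1 ^+ (2 * m) / t2 ^+ (2 * m).
    by rewrite -exprM -expr_div_n.
  by rewrite [X in _ -> X <= _]mulrAC ler_pdivrMr ?exprn_gt0// mulrC.
have gap t : t1 <= t <= t2 -> theta * rho ^+ m * qp <= q m.-1 t - q m t.
  move=> t12'; have /andP[h1 h2] := t12'; have /andP[lo _] := mono t t12'.
  have := ratio t; rewrite (lt_le_trans t10 h1) h2 => /(_ isT).
  apply: le_trans; rewrite -!mulrA ler_pM2l//.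
  apply: le_trans (_ : r ^+ m * (g ^+ 2 ^+ m * qp) <= _); last first.
    by rewrite ler_pM2l// exprn_gt0//; lra.
  rewrite mulrA -exprMn ler_pM2r//; apply: lerXn2r => //; rewrite nnegrE.
    by rewrite /rho; lra.
  by rewrite mulr_ge0 ?sqr_ge0//; lra.
(* [K = 1600 * 40]: as [n >= 1 / (40 * qp)], the mean number of tallies at [m] is at least 1600, and
   [32 / 1600 = 1 / 50]. Moreover [K * qp <= 1] makes [n >= 5]. *)
set K : R := 64 * 10 ^+ 3 in big.
have bigK : K <= theta * rho ^+ m.
  have h : 1 + m%:R * ((r - 1) / 2) <= rho ^+ m.
    have -> : rho = 1 + (r - 1) / 2 by rewrite /rho; lra.
    by apply: bernoulli; lra.
  apply: le_trans big _; rewrite ler_pM2l//; apply: le_trans h.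
  by rewrite lerDr.
have Kqp : K * qp <= 1.
  have [_ h1 _] := passage_props alpha_gt1 m.-1 (ltW t20).
  have [h2 _ _] := passage_props alpha_gt1 m (ltW t20).
  have h3 : K * qp <= theta * rho ^+ m * qp by rewrite ler_pM2r.
  by have := gap t2; rewrite t12 lexx => /(_ isT); lra.
have KE : K = 1600 * 40 by rewrite /K !exprS expr0; lra.
rewrite KE in Kqp.
pose y := (20 * qp)^-1; pose n := Num.truncn y.
have q20 : 0 < 20 * qp by rewrite mulr_gt0.
have y0 : 0 < y by rewrite invr_gt0.
have yqp : y * qp = 20^-1 by rewrite /y; field; rewrite gt_eqF.
have y5 : 6 <= y by rewrite -(ler_pM2r qp0) yqp; lra.
have /andP[nl nu] : n%:R <= y < n.+1%:R by apply: truncn_itv; exact: ltW.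
have nu' : y < n%:R + 1 by rewrite natr1.
exists n; split; first by rewrite -ltnS -(ltr_nat R); lra.
move=> t tt; have /andP[h1 h2] := tt;
have t0 : 0 <= t by rewrite (le_trans (ltW t10)).
have /andP[_ qq] := mono t tt.
have [p0 p1 _] := passage_props alpha_gt1 (2 * m) t0.
have [_ u1 _] := passage_props alpha_gt1 m.-1 t0.
have [_ v1 _] := passage_props alpha_gt1 m t0.
have xm : q (2 * m) t <= q m t.
  by apply: passage_anti => //; rewrite mul2n -addnn leq_addr.
have ym : q m t <= q m.-1 t by apply: passage_anti => //; exact: leq_pred.
have nqp : n%:R * qp <= 20^-1 by rewrite -yqp ler_pM2r.
apply: (@good_integrand_ge _ _ 1600).
- by rewrite p0.
- by lra.
- by apply: le_trans nqp; rewrite ler_wpM2l.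
- by rewrite ltr0n.
- have h3 : 1600 * 40 * qp <= q m.-1 t - q m t.
    by apply: le_trans (gap t tt); rewrite -KE ler_pM2r.
  apply: le_trans (ler_wpM2l (ler0n R n) h3).
  have h4 : y / 2 <= n%:R by lra.
  have : y / 2 * qp <= n%:R * qp by rewrite ler_pM2r.
  by lra.
- by lra.
- by rewrite subr_ge0.
Qed.

End Conclusion.

(** * Choice of the constants *)

Section GoodValue.
Variables (R : realType) (alpha : R).
Hypothesis alpha_gt1 : 1 < alpha.
Local Notation explosion := (explosion alpha).
Local Notation C := (tail_const alpha).
Local Notation q := (passage alpha).

Lemma good_value_init_large : exists m0, forall m, (m0 <= m)%N ->
  exists n, (5 <= n)%N /\ 17 / 20 <= good_value alpha m (@initial_state m n).
Proof.
have C0 : 0 < C by exact: tail_const_gt0.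
have C20 : 0 < 2 * C by rewrite mulr_gt0.
(* The scale [2 * C] covers the window, which ends at [T * (1 + delta)] with [T <= C / mu] and
   [delta <= 1 / 8]. *)
have [theta [m1 [th0 ratio]]] := birth_exact_ratio alpha_gt1 C20.
set r := 1 + theta / 2 `^ alpha in ratio.
have p2 : 0 < 2 `^ alpha :> R by rewrite powR_gt0.
have r1 : 1 < r by rewrite ltrDl divr_gt0.
have [delta [d0 d1 rg]] := ratio_margin r1.
(* [beta0] bounds [- ln b] from below uniformly in [m], hence [eta0] bounds the deviation [eta] of
   the window. *)
pose beta0 := ln (1 + (2 `^ alpha)^-1 : R).
have beta00 : 0 < beta0 by rewrite ln_gt0// ltrDl invr_gt0.
pose eta0 : R := 1 - expR (- (delta * beta0)).
have eta00 : 0 < eta0 by rewrite subr_gt0 expR_lt1 oppr_lt0 mulr_gt0.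
pose x1 := 64 * 10 ^+ 3 / (theta * ((r - 1) / 2)).
have tr0 : 0 < theta * ((r - 1) / 2) by rewrite mulr_gt0//; lra.
have x10 : 0 <= x1 by rewrite divr_ge0 ?(ltW tr0)// mulr_ge0 ?exprn_ge0.
(* Makes the Chebyshev term, at most [2 * C / (m * eta0 ^ 2)], no larger than [1 / 250]. *)
pose x3 := 500 * C / eta0 ^+ 2.
have x30 : 0 <= x3.
  exact: divr_ge0 (mulr_ge0 (ler0n _ 500) (ltW C0)) (sqr_ge0 _).
pose X : R := `|m1| + x1 + 2 * C + x3.
have X0 : 0 <= X by rewrite /X !addr_ge0// ltW.
exists (Num.bound X).+1 => m mX.
have XM : X <= m%:R.
  by apply/ltW/(lt_le_trans (archi_boundP X0)); rewrite ler_nat ltnW.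
have m0 : (0 < m)%N by exact: leq_trans mX.
have mR0 : 0 < m%:R :> R by rewrite ltr0n.
have [m1m x1m C2m x3m] : [/\ m1 <= m%:R, x1 <= m%:R, 2 * C <= m%:R & x3 <= m%:R].
  have := ler_norm m1; have := normr_ge0 m1; move: XM C20 x10 x30; rewrite /X.
  by clear => *; split; lra.
pose mu : R := m%:R `^ alpha / m%:R; pose b := explosion m mu.
have [] := explosion_scaled alpha_gt1 m0; rewrite -/mu -/b.
move=> mu0 mum b01 /andP[lnl lnu] dbl.
pose T := - ln b / mu; pose t1 := T * (1 - delta); pose t2 := T * (1 + delta).
have T0 : 0 < T by rewrite divr_gt0// (lt_le_trans beta00).
have t10 : 0 < t1 by rewrite mulr_gt0// subr_gt0 (le_lt_trans d1)//; lra.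
have t12 : t1 <= t2 by rewrite ler_pM2l// lerD2l; move: d0; clear; lra.
have t2tau : t2 <= 2 * C * m%:R `^ (1 - alpha).
  rewrite mum /t2 /T mulrAC ler_pM2r ?invr_gt0//.
  have h1 : 0 <= 1 + delta by rewrite addr_ge0// ltW.
  apply: le_trans (ler_wpM2r h1 lnu) _; rewrite mulrC ler_pM2r//.
  by move: d1; clear; lra.
have gE : t1 / t2 = (1 - delta) / (1 + delta).
  have T1 : T != 0 := lt0r_neq0 T0.
  by rewrite /t1 /t2 -mulf_div divff// mul1r.
have [|||n [n5 win]] := @window_choice _ _ alpha_gt1 m theta r t1 t2 th0 r1 t10 t12.
- by rewrite gE.
- by rewrite [leRHS]mulrCA -ler_pdivrMr; [exact: x1m|exact: tr0].
- move=> t /andP[h1 h2]; apply: ratio => //.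
  by rewrite h1 (le_trans h2).
exists n; split=> //; apply: (good_value_init_ge alpha_gt1) => // s st sE.
pose V := (explosion m (2 * mu) - b ^+ 2) / (b * (1 - expR (delta * ln b))) ^+ 2.
have VE : V <= 250^-1.
  have /andP[b0 _] := b01.
  have e0 : eta0 <= 1 - expR (delta * ln b).
    by rewrite lerD2l lerN2 ler_expR -mulrN ler_pM2l// lerNr.
  have e1 := lt_le_trans eta00 e0.
  have yb : 0 <= C / m%:R <= 2^-1.
    rewrite divr_ge0 ?(ltW C0) ?(ltW mR0)//= ler_pdivrMr//.
    by move: C2m; clear; lra.
  have := expR_sub1_le yb; set e := expR (C / _) => eb.
  have V1 : V <= (e - 1) / (1 - expR (delta * ln b)) ^+ 2.
    rewrite /V exprMn invfM mulrA ler_pM2r ?invr_gt0 ?exprn_gt0//.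
    rewrite ler_pdivrMr ?exprn_gt0//; move: dbl; rewrite -/e; clear; lra.
  have V2 : V * eta0 ^+ 2 <= e - 1.
    have e2 : eta0 ^+ 2 <= (1 - expR (delta * ln b)) ^+ 2.
      by apply: lerXn2r => //; rewrite nnegrE ltW.
    have em : 0 <= e - 1.
      by rewrite subr_ge0 -expR0 ler_expR; case/andP: yb.
    have := ler_wpM2r (sqr_ge0 eta0) V1.
    move=> /le_trans; apply; rewrite mulrAC ler_pdivrMr ?exprn_gt0//.
    exact: ler_wpM2l.
  have eta2 : 0 < eta0 ^+ 2 by rewrite exprn_gt0.
  have x3' : 500 * C <= m%:R * eta0 ^+ 2 by rewrite -ler_pdivrMr.
  have h : 2 * (C / m%:R) <= 250^-1 * eta0 ^+ 2.
    rewrite mulrA ler_pdivrMr//; move: x3'; clear; lra.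
  rewrite -(ler_pM2r eta2); apply: le_trans V2 _; exact: le_trans eb h.
(* The worst case outside the window; [93 / 100 - (93 / 100 + 16) / 250] still exceeds [17 / 20]. *)
have low t : 0 <= t -> - 16 <= ev s t.
  move=> t0; rewrite sE//.
  have [p0 p1 _] := passage_props alpha_gt1 (2 * m) t0.
  have [_ u1 _] := passage_props alpha_gt1 m.-1 t0.
  have [_ v1 _] := passage_props alpha_gt1 m t0.
  have xm : q (2 * m) t <= q m t.
    by apply: passage_anti => //; rewrite mul2n -addnn leq_addr.
  have ym : q m t <= q m.-1 t by apply: passage_anti => //; exact: leq_pred.
  have w1 : 0 <= (1 - q (2 * m) t) ^+ n by rewrite exprn_ge0// subr_ge0.
  have w2 : (1 - q (2 * m) t - (q m.-1 t - q m t) / 2) ^+ n <= 1.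
    by apply: exprn_ile1; move: p0 p1 u1 v1 xm ym; clear; lra.
  by move: w1 w2; clear; lra.
have win' t : - ln b / mu * (1 - delta) <= t <= - ln b / mu * (1 + delta) ->
    93 / 100 <= ev s t.
  move=> ht; rewrite sE; first exact: win.
  by case/andP: ht => h _; rewrite (le_trans (ltW t10)).
have := @lap_explosion_window R alpha m mu delta (93 / 100) 16 s m0 mu0 d0 b01.
rewrite -/V => h; have c0 : (0 : R) <= 16 by rewrite ler0n.
have c1 : (0 : R) <= 93 / 100 by rewrite divr_ge0 ?ler0n.
apply: le_trans (h c0 c1 st low win').
by move: VE; clear; lra.
Qed.

End GoodValue.

Unset Implicit Arguments.

Local Open Scope ereal_scope.

Theorem theorem1 (R : realType) (alpha : R) (alpha_gt1 : (1 < alpha)%R) :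
  exists m0 : nat, forall m : nat, (m0 <= m)%N ->
  exists n : nat, (5 <= n)%N /\
  forall (d : measure_display) (T : measurableType d) (P : probability T R)
    (U : nat -> {RV P >-> R}),
    (forall j, uniform01 (U j)) -> mutually_independent U ->
    let E := [set w : T |
      only_0_selected_often alpha m n (fun j => U j w) /\
      five_selected_exactly alpha m n (fun j => U j w)] in
    measurable E /\ ((4 / 5)%R)%:E < P E.
Proof.
have [m0 large] := good_value_init_large alpha_gt1.
exists m0.+1 => m mm0; have [n [n5 vn]] := large m (ltnW mm0).
have m_gt0 : (0 < m)%N by exact: leq_trans mm0.
exists n; split=> // d T P U Uu Ui E.
have [mE PE] := good_event_prob n alpha_gt1 m_gt0 Uu Ui.
split=> //; apply: lt_le_trans PE.
by rewrite lte_fin (lt_le_trans _ vn)//; lra.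
Qed.
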